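(* Let $(R,\mathfrak m)$ be a local OK domain of prime characteristic $p>0$ and dimension $d$, and let $I_\bullet$ be a $p$-family of $\mathfrak m$-primary ideals of $R$. Then $\operatorname{vol}_R(I_\bullet)>0$ if and only if there exists a power $q_\circ$ of $p$ such that $I_{qq_\circ}\subseteq\mathfrak m^{[q]}$ for all powers $q$ of $p$.
   Context: $p$ prime; $q$ denotes powers $p^e$, $e\ge0$. $I^{[q]}$ is the ideal generated by $\{x^q:x\in I\}$. A $p$-family of ideals is a sequence $\{I_q\}$ indexed by powers of $p$ with $I_q^{[p]}\subseteq I_{pq}$. $\operatorname{vol}_R(I_\bullet)=\lim_{q\to\infty}\ell_R(R/I_q)/q^d$ (this limit exists for $p$-families of $\mathfrak m$-primary ideals in OK domains). OK domain: fix $\mathbf a\in\mathbb R^d$ with $\mathbb Q$-linearly independent coordinates; order $\mathbb Z^d$ by $\mathbf u\le\mathbf v$ iff $\langle\mathbf u,\mathbf a\rangle\le\langle\mathbf v,\mathbf a\rangle$. A valuation $\nu:\mathbb F^\times\to\mathbb Z^d$ (surjective homomorphism, $\nu(x+y)\ge\min\{\nu(x),\nu(y)\}$ when $x,y,x+y\neq 0$) on the fraction field $\mathbb F$ of a $d$-dimensional local domain $(D,\mathfrak m,\Bbbk)$, with $\mathbb F_{\ge\mathbf u}=\{0\}\cup\{x:\nu(x)\ge\mathbf u\}$, valuation ring $V=\mathbb F_{\ge\mathbf 0}$ with maximal ideal $\mathfrak m_V$ and residue field $\Bbbk_V$, is OK relative to $D$ if (i) $D\subseteq V$, $\mathfrak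 m=\mathfrak m_V\cap D$; (ii) $\langle\mathbf u,\mathbf a\rangle>0$ for every nonzero $\mathbf u$ in the closed convex cone generated by $\nu(D\setminus0)$; (iii) $[\Bbbk_V:\Bbbk]<\infty$; (iv) there is $\mathbf v\in\mathbb Z^d$ with $D\cap\mathbb F_{\ge n\mathbf v}\subseteq\mathfrak m^n$ for all $n\ge0$. $D$ is OK if such $\nu$ exists. *)

(* Defs.v *)
From Stdlib Require Import Reals ZArith ClassicalEpsilon.
From HB Require Import structures.
From mathcomp Require Import all_boot all_order all_algebra.
From mathcomp Require Import fraction.

Set Implicit Arguments.
Unset Strict Implicit.
Unset Printing Implicit Defensive.

Import GRing.Theory.
Local Open Scope ring_scope.

Definition is_ideal (A : idomainType) (I : A -> Prop) : Prop :=
  I 0 /\ (forall x y, I x -> I y -> I (x + y)) /\ (forall r x, I x -> I (r * x)).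

Definition psubset (A : idomainType) (I J : A -> Prop) : Prop := forall x, I x -> J x.

Definition strict_sub (A : idomainType) (I J : A -> Prop) : Prop :=
  psubset I J /\ exists x, J x /\ ~ I x.

Definition ideal_gen (A : idomainType) (S : A -> Prop) : A -> Prop :=
  fun x => exists rs : seq (A * A),
    List.Forall (fun t => S t.2) rs /\ x = \sum_(t <- rs) t.1 * t.2.

Definition frob_pow (A : idomainType) (I : A -> Prop) (q : nat) : A -> Prop :=
  ideal_gen (fun y => exists x, I x /\ y = x ^+ q).

Definition ideal_pow (A : idomainType) (I : A -> Prop) (n : nat) : A -> Prop :=
  ideal_gen (fun y => exists f : 'I_n -> A, (forall i, I (f i)) /\ y = \prod_(i < n) f i).

Definition is_prime_ideal (A : idomainType) (P : A -> Prop) : Prop :=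
  is_ideal P /\ ~ P 1 /\ (forall a b, P (a * b) -> P a \/ P b).

Definition noetherian (A : idomainType) : Prop :=
  forall c : nat -> A -> Prop, (forall i, is_ideal (c i)) ->
    (forall i, psubset (c i) (c i.+1)) ->
    exists n, forall k, (n <= k)%N -> psubset (c k) (c n).

Definition is_local (A : idomainType) (m : A -> Prop) : Prop :=
  is_ideal m /\ ~ m 1 /\ (forall x, ~ m x -> x \is a GRing.unit).

Definition prime_chain (A : idomainType) (n : nat) (c : nat -> A -> Prop) : Prop :=
  (forall i, (i <= n)%N -> is_prime_ideal (c i)) /\
  (forall i, (i < n)%N -> strict_sub (c i) (c i.+1)).

Definition krull_dim (A : idomainType) (d : nat) : Prop :=
  (exists c : nat -> A -> Prop, prime_chain d c) /\
  (forall n (c : nat -> A -> Prop), prime_chain n c -> (n <= d)%N).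

Definition m_primary (A : idomainType) (m I : A -> Prop) : Prop :=
  is_ideal I /\ psubset I m /\ (forall x, m x -> exists n, I (x ^+ n)).

Definition ideal_chain_to_top (A : idomainType) (I : A -> Prop) (n : nat) : Prop :=
  exists c : nat -> A -> Prop,
    (forall x, c 0%N x <-> I x) /\ (forall x, c n x) /\
    (forall i, (i <= n)%N -> is_ideal (c i)) /\
    (forall i, (i < n)%N -> strict_sub (c i) (c i.+1)).

Definition colength_is (A : idomainType) (I : A -> Prop) (n : nat) : Prop :=
  ideal_chain_to_top I n /\ (forall k, ideal_chain_to_top I k -> (k <= n)%N).

(* ell_A(A/I) (well defined, finite, when I is m-primary in a Noetherian local ring) *)
Definition colength (A : idomainType) (I : A -> Prop) : nat :=
  epsilon (inhabits 0%N) (colength_is I).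

(* p-family of ideals, indexed by the exponent: I e = I_{p^e} *)
Definition p_family (A : idomainType) (p : nat) (I : nat -> A -> Prop) : Prop :=
  forall e, psubset (frob_pow (I e) p) (I e.+1).

Definition ipZ (d : nat) (u : 'I_d -> Z) (a : 'I_d -> R) : R :=
  \big[Rplus/R0]_(i < d) Rmult (IZR (u i)) (a i).

Definition ipR (d : nat) (u : 'I_d -> R) (a : 'I_d -> R) : R :=
  \big[Rplus/R0]_(i < d) Rmult (u i) (a i).

Definition Qlin_indep (d : nat) (a : 'I_d -> R) : Prop :=
  forall c : 'I_d -> Z, ipZ c a = R0 -> forall i, c i = Z0.

(* nu : F^x -> Z^d surjective homomorphism, nu(x+y) >= min(nu x, nu y) for the
   order u <= v iff <u,a> <= <v,a>; values at 0 are irrelevant *)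
Definition is_valuation (F : fieldType) (d : nat) (a : 'I_d -> R)
    (nu : F -> 'I_d -> Z) : Prop :=
  (forall x y, x != 0 -> y != 0 -> forall i, nu (x * y) i = Z.add (nu x i) (nu y i)) /\
  (forall u : 'I_d -> Z, exists x, x != 0 /\ forall i, nu x i = u i) /\
  (forall x y, x != 0 -> y != 0 -> x + y != 0 ->
     Rle (Rmin (ipZ (nu x) a) (ipZ (nu y) a)) (ipZ (nu (x + y)) a)).

Definition inV (F : fieldType) d (a : 'I_d -> R) (nu : F -> 'I_d -> Z) (x : F) : Prop :=
  x = 0 \/ Rle R0 (ipZ (nu x) a).
Definition inmV (F : fieldType) d (a : 'I_d -> R) (nu : F -> 'I_d -> Z) (x : F) : Prop :=
  x = 0 \/ Rlt R0 (ipZ (nu x) a).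

Definition in_cone d (S : ('I_d -> Z) -> Prop) (u : 'I_d -> R) : Prop :=
  exists l : seq (R * ('I_d -> Z)),
    List.Forall (fun t => Rle R0 t.1 /\ S t.2) l /\
    forall i, u i = \big[Rplus/R0]_(t <- l) Rmult t.1 (IZR (t.2 i)).

Definition in_closed_cone d (S : ('I_d -> Z) -> Prop) (u : 'I_d -> R) : Prop :=
  forall eps, Rlt R0 eps -> exists w, in_cone S w /\
    forall i, Rlt (Rabs (Rminus (u i) (w i))) eps.

Definition OK_relative (A : idomainType) (m : A -> Prop) (d : nat)
    (a : 'I_d -> R) (nu : {fraction A} -> 'I_d -> Z) : Prop :=
  is_valuation a nu /\
  (forall r : A, inV a nu (tofrac r)) /\
  (forall r : A, m r <-> inmV a nu (tofrac r)) /\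
  (forall u : 'I_d -> R,
     in_closed_cone (fun v => exists r : A, r != 0 /\ forall i, v i = nu (tofrac r) i) u ->
     (exists i, u i <> R0) -> Rlt R0 (ipR u a)) /\
  (* (iii) [k_V : k] finite: k_V is spanned over k by finitely many elements *)
  (exists s : seq {fraction A}, List.Forall (inV a nu) s /\
     forall v, inV a nu v -> exists cs : seq A, size cs = size s /\
       inmV a nu (v - \sum_(j < size s) tofrac (nth 0 cs j) * nth 0 s j)) /\
  (exists v : 'I_d -> Z, forall (n : nat) (r : A),
     (tofrac r = 0 \/
      Rle (ipZ (fun i => Z.mul (Z.of_nat n) (v i)) a) (ipZ (nu (tofrac r)) a)) ->
     ideal_pow m n r).

Definition is_OK (A : idomainType) (m : A -> Prop) (d : nat) : Prop :=
  exists (a : 'I_d -> R) (nu : {fraction A} -> 'I_d -> Z),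
    Qlin_indep a /\ OK_relative m a nu.

Definition vol_seq (A : idomainType) (p d : nat) (I : nat -> A -> Prop) (e : nat) : R :=
  Rdiv (INR (colength (I e))) (pow (INR (expn p e)) d).

(* Main.v *)
(** Write S for the semigroup of values of R and T_q for the set of values of I_q; an
    OK valuation embeds both in Z^d, and S lies in a strip on which the height <u,a>
    dominates all coordinates, so only O(t^d) values have height < t and a slab of bounded
    width holds O(t^(d-1)) of them.  As R_(>= Nq) is contained in I_q for a constant N, the
    length of R/I_q equals [k_V : k] (#S - #T_q), counted below height Nq, up to the number
    of values in such a slab.

    For a suitable s, the set k s + [0,k)^d lies in S for all k, hence
    p^k (T_q + s) + [0,p^k)^d lies in T_(q p^k).  So the normalised counts are increasing
    up to O(1/q) and converge; no convex geometry is needed.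

    If I_(q q0) is contained in m^[q], all its values have height >= delta q, so a positive
    proportion of S is missed.  Conversely, an x in I_(q q0) outside m^[q] has height < C q,
    and x^(q') R is contained in I_(q q0 q'); so all values outside a slab of relative width
    C/q0 are attained and the volume is O(1/q0). *)

Require Import Defs.
From Stdlib Require Import Reals ZArith Lra Lia ClassicalEpsilon.
From HB Require Import structures.
From mathcomp Require Import all_boot all_order all_algebra.
From mathcomp Require Import fraction generic_quotient boolp ssrZ.
From mathcomp Require ring.

Set Implicit Arguments.
Unset Strict Implicit.
Unset Printing Implicit Defensive.

Import GRing.Theory.
Local Delimit Scope R_scope with RR.
Local Delimit Scope Z_scope with ZZ.
Local Open Scope ring_scope.

(** Colength is a maximum over chains of ideals, so it is enclosed from two sides. From below, a
    chain is built whose steps realise, at heights that I misses, f = [k_V : k] independent leading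
    forms of elements of R. From above, each step of an arbitrary chain is charged to a value, and
    at most f steps can share one. The two sides do not meet exactly: at a value of R or of I the
    leading forms need not fill a whole copy of k_V. Multiplying by f elements of R with independent
    leading forms fills it, at the price of a fixed shift w; this is why slabs of bounded width have
    to be negligible. No residue field is formed: k-linear algebra is done in F modulo F_(> t) with
    coefficients in R, where an element outside m is a unit. The truncation height must be linear in
    q. It comes from an exponent c with x^c in I_1 for the generators x of m, since then x^(c q)
    lies in I_q, and from condition (iv). *)

HB.instance Definition _ := Monoid.isComLaw.Build R R0 Rplus
  (fun x y z => esym (Rplus_assoc x y z)) Rplus_comm Rplus_0_l.

(** * Heights of lattice vectors and closed cones *)

Section RealSums.

Lemma Rsum_scale (I : Type) (r : seq I) (c : R) (F : I -> R) :
  \big[Rplus/R0]_(i <- r) (c * F i)%RR = (c * \big[Rplus/R0]_(i <- r) F i)%RR.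
Proof.
elim: r => [|i r IH]; first by rewrite !big_nil Rmult_0_r.
by rewrite !big_cons IH Rmult_plus_distr_l.
Qed.

Lemma Rsum_le (I : Type) (r : seq I) (F G : I -> R) :
  (forall i, (F i <= G i)%RR) ->
  (\big[Rplus/R0]_(i <- r) F i <= \big[Rplus/R0]_(i <- r) G i)%RR.
Proof.
move=> FG; elim: r => [|i r IH]; first by rewrite !big_nil; lra.
by rewrite !big_cons; apply: Rplus_le_compat.
Qed.

Lemma Rsum_ge0 (I : Type) (r : seq I) (F : I -> R) :
  (forall i, (0 <= F i)%RR) -> (0 <= \big[Rplus/R0]_(i <- r) F i)%RR.
Proof.
move=> F0; elim: r => [|i r IH]; first by rewrite !big_nil; lra.
by rewrite !big_cons; have := F0 i; lra.
Qed.

Lemma Rsum_term (I : finType) (F : I -> R) (i : I) :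
  (forall i, (0 <= F i)%RR) -> (F i <= \big[Rplus/R0]_j F j)%RR.
Proof.
move=> F0; rewrite (bigD1 i) //=.
suff : (0 <= \big[Rplus/R0]_(j | j != i) F j)%RR by lra.
by rewrite big_mkcond; apply: Rsum_ge0 => j; case: ifP => _ //; lra.
Qed.

End RealSums.

Section Heights.

Variables (d : nat) (a : 'I_d -> R).

Notation vect := {ffun 'I_d -> Z}.

(** Values become finite functions here: this gives them decidable equality, needed for lists
    without repetition, and a group structure. *)
Definition ht (u : vect) : R := ipZ u a.

Lemma htD u v : ht (u + v) = (ht u + ht v)%RR.
Proof.
rewrite /ht /ipZ -big_split; apply: eq_bigr => i _.
by rewrite ffunE [IZR _]plus_IZR Rmult_plus_distr_r.
Qed.

Lemma ht0 : ht 0 = 0%RR.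
Proof.
rewrite /ht /ipZ big1 // => i _; rewrite ffunE.
by rewrite [IZR _]/(IZR 0) Rmult_0_l.
Qed.

Lemma htN u : ht (- u) = (- ht u)%RR.
Proof. by have := htD u (- u); rewrite subrr ht0; lra. Qed.

Lemma htMn u k : ht (u *+ k) = (INR k * ht u)%RR.
Proof.
elim: k => [|k IH]; first by rewrite mulr0n ht0 Rmult_0_l.
by rewrite mulrSr htD IH S_INR; lra.
Qed.

Lemma ht_inj : Qlin_indep a -> injective ht.
Proof.
move=> qa u v e; apply/eqP; rewrite -subr_eq0; apply/eqP/ffunP => i.
rewrite [RHS]ffunE; apply: qa.
by rewrite -/(ht _) htD htN e; lra.
Qed.

Definition l1 := \big[Rplus/R0]_(i < d) Rabs (a i).

Lemma l1_ge0 : (0 <= l1)%RR.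
Proof. by apply: Rsum_ge0 => i; apply: Rabs_pos. Qed.

Lemma ipR_lipschitz (u w : 'I_d -> R) eps :
  (forall i, (Rabs (u i - w i) <= eps)%RR) ->
  (ipR u a <= ipR w a + eps * l1)%RR.
Proof.
move=> uw; rewrite /ipR /l1 -Rsum_scale -big_split; apply: Rsum_le => i /=.
have := uw i; have : ((u i - w i) * a i <= Rabs (u i - w i) * Rabs (a i))%RR.
  by rewrite -Rabs_mult; apply: Rle_abs.
have := Rabs_pos (a i); nra.
Qed.

Lemma ht_lt_l1 (r : vect) k :
  (forall i, (0 <= r i < Z.of_nat k)%ZZ) -> (ht r <= INR k * l1)%RR.
Proof.
move=> rk; rewrite /ht /ipZ /l1 -Rsum_scale; apply: Rsum_le => i.
have [/IZR_le r0 /IZR_lt r1] := rk i; move: r1; rewrite -INR_IZR_INZ => r1.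
have := Rle_abs (a i); have := Rabs_pos (a i); nra.
Qed.

End Heights.

(** * Compactness: from the closed cone to a strip *)

Section Compactness.

Lemma bolzano_weierstrass_cube d (w : nat -> 'I_d -> R) :
  (forall n i, (Rabs (w n i) <= 1)%RR) ->
  exists l : 'I_d -> R, forall eps n0, (0 < eps)%RR ->
    exists2 n, (n0 <= n)%N & forall i, (Rabs (w n i - l i) < eps)%RR.
Proof.
move=> w1.
have sub k : exists phi : nat -> nat, exists l : 'I_d -> R,
  (forall n, (n <= phi n)%N) /\ forall eps, (0 < eps)%RR ->
  exists n0, forall n, (n0 <= n)%N -> forall i : 'I_d, (i < k)%N ->
    (Rabs (w (phi n) i - l i) < eps)%RR.
  elim: k => [|k [phi [l [phin lim]]]].
    by exists id, (fun=> 0%RR); split=> // eps _; exists 0%N.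
  case: (ltnP k d) => kd; last first.
    exists phi, l; split=> // eps /lim[n0 h]; exists n0 => n nn i _.
    by apply: h => //; apply: leq_trans kd.
  pose x n := w (phi n) (Ordinal kd).
  have [l' adh] : exists l', ValAdh x l'.
    apply: (@Bolzano_Weierstrass x (fun c => (-1 <= c <= 1)%RR) (compact_P3 _ _)).
    by move=> n; have := w1 (phi n) (Ordinal kd); rewrite /x /Rabs; case: Rcase_abs; lra.
  have pick n : exists m, (n <= m)%N /\ (Rabs (x m - l') < / INR n.+1)%RR.
    have e0 : (0 < / INR n.+1)%RR by apply: Rinv_0_lt_compat; apply: lt_0_INR; lia.
    have [|m [/leP nm xm]] := adh (disc l' (mkposreal _ e0)) n.
      by exists (mkposreal _ e0).
    by exists m.
  have [psi psiP] := choice pick.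
  exists (phi \o psi), (fun i => if i == Ordinal kd then l' else l i); split.
    by move=> n /=; have [h _] := psiP n; apply: leq_trans (phin _).
  move=> eps eps0; have [n0 h] := lim _ eps0.
  have [n1 h1] : exists n1, (/ INR n1.+1 < eps)%RR.
    have [n1 [h1 h2]] := archimed_cor1 _ eps0.
    exists n1; apply: Rle_lt_trans h1; apply: Rinv_le_contravar; first exact: lt_0_INR.
    by apply: le_INR; lia.
  exists (maxn n0 n1) => n; rewrite geq_max => /andP[nn0 nn1] i ik /=.
  have [np xp] := psiP n; case: eqP => [->|ne].
    apply: Rlt_trans xp _; apply: Rle_lt_trans h1; apply: Rinv_le_contravar.
      by apply: lt_0_INR; lia.
    by apply: le_INR; apply/leP.
  apply: h; first exact: leq_trans np.
  rewrite ltn_neqAle -ltnS ik andbT; apply/eqP => e; apply: ne; exact: val_inj.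
have [phi [l [phin lim]]] := sub d.
exists l => eps n0 /lim[n1 h]; exists (phi (maxn n0 n1)).
  by apply: leq_trans (phin _); apply: leq_maxl.
by move=> i; apply: h => //; apply: leq_maxr.
Qed.

(** If no delta worked, there would be elements v of S with height below |v| / (n + 1). Scaled to
    norm one, they have a cluster point, which lies in the closed cone, is non-zero, and has height
    at most 0, against positivity on the cone. *)
Lemma cone_height_bound d (a : 'I_d -> R) (S : ('I_d -> Z) -> Prop) :
  (forall u, in_closed_cone S u -> (exists i, u i <> R0) -> (0 < ipR u a)%RR) ->
  exists2 delta, (0 < delta)%RR &
    forall v, S v -> forall i, (delta * Rabs (IZR (v i)) <= ipZ v a)%RR.
Proof.
move=> pos; apply: NNPP => no.
pose nrm (v : 'I_d -> Z) := \big[Rplus/R0]_(i < d) Rabs (IZR (v i)).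
have nrm_term v i : (Rabs (IZR (v i)) <= nrm v)%RR.
  by apply: (@Rsum_term _ (fun i => Rabs (IZR (v i)))) => j; apply: Rabs_pos.
have bad n : exists v, S v /\ (ipZ v a < / INR n.+1 * nrm v)%RR.
  have e0 : (0 < / INR n.+1)%RR by apply: Rinv_0_lt_compat; apply: lt_0_INR; lia.
  apply: NNPP => nv; apply: no; exists (/ INR n.+1)%RR => // v Sv i.
  apply: Rnot_lt_le => h; apply: nv; exists v; split=> //.
  by have := nrm_term v i; nra.
have [v vP] := choice bad.
have nrm0 n : (0 < nrm (v n))%RR.
  case: (Rle_lt_dec (nrm (v n)) 0) => // h; have [_] := vP n.
  have n0 : nrm (v n) = 0%RR.
    by apply: Rle_antisym => //; apply: Rsum_ge0 => i; apply: Rabs_pos.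
  have -> : ipZ (v n) a = 0%RR; last by rewrite n0; lra.
  rewrite /ipZ big1 // => i _; have := nrm_term (v n) i; rewrite n0 => h'.
  have -> : IZR (v n i) = 0%RR.
    by move: h'; rewrite /Rabs; case: Rcase_abs; lra.
  by rewrite Rmult_0_l.
pose w n i := (/ nrm (v n) * IZR (v n i))%RR.
have absw n i : Rabs (w n i) = (/ nrm (v n) * Rabs (IZR (v n i)))%RR.
  by rewrite /w Rabs_mult Rabs_inv (Rabs_pos_eq (nrm _)) //; have := nrm0 n; lra.
have w1 n i : (Rabs (w n i) <= 1)%RR.
  rewrite absw -(Rinv_l (nrm (v n))); last by have := nrm0 n; lra.
  apply: Rmult_le_compat_l => //; left; exact: Rinv_0_lt_compat.
have [l lP] := bolzano_weierstrass_cube w1.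
have cl : in_closed_cone S l.
  move=> eps /(lP _ 0%N)[n _ h]; exists (w n); split.
    exists [:: (/ nrm (v n), v n)%RR]; split.
      constructor=> //=; split; last by have [] := vP n.
      by left; apply: Rinv_0_lt_compat.
    by move=> i; rewrite big_seq1.
  by move=> i; rewrite Rabs_minus_sym; apply: h.
have ipw n : (ipR (w n) a <= / INR n.+1)%RR.
  have -> : ipR (w n) a = (/ nrm (v n) * ipZ (v n) a)%RR.
    rewrite /ipR /ipZ -Rsum_scale; apply: eq_bigr => i _.
    by rewrite /w Rmult_assoc.
  have [_ h] := vP n; have := nrm0 n => h0.
  rewrite -[X in (_ <= X)%RR]Rmult_1_l -(Rinv_l (nrm (v n))); last lra.
  rewrite Rmult_assoc; apply: Rmult_le_compat_l; last lra.
  by left; apply: Rinv_0_lt_compat.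
(* The cluster point is non-zero because each [w n] has norm one. The + 1 next to [D], which is d as
   a real, keeps the quotient defined for d = 0. *)
have suml : (1 <= \big[Rplus/R0]_(i < d) Rabs (l i))%RR.
  apply: Rnot_lt_le => h; set s := (\big[_/_]_(i < d) _) in h.
  pose D := \big[Rplus/R0]_(i < d) 1%RR.
  have D0 : (0 <= D)%RR by apply: Rsum_ge0 => i; lra.
  have e0 : (0 < (1 - s) / (D + 1))%RR by apply: Rdiv_lt_0_compat; lra.
  have [n _ hn] := lP _ 0%N e0.
  have : (\big[Rplus/R0]_(i < d) Rabs (w n i) <= s + (1 - s) / (D + 1) * D)%RR.
    rewrite /s /D -Rsum_scale -big_split; apply: Rsum_le => i /=.
    have := hn i; have := Rabs_triang (w n i - l i) (l i).
    rewrite (_ : (w n i - l i + l i)%RR = w n i); last by ring.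
    by move: ((1 - s) / (D + 1))%RR => q; lra.
  have -> : (\big[Rplus/R0]_(i < d) Rabs (w n i) = 1)%RR.
    under eq_bigr do rewrite absw.
    by rewrite Rsum_scale Rinv_l //; have := nrm0 n; lra.
  have : ((1 - s) / (D + 1) * (D + 1) = 1 - s)%RR by field; lra.
  lra.
have nz : exists i, l i <> R0.
  apply: NNPP => h; move: suml; rewrite big1; first lra.
  move=> i _; case: (Req_dec (l i) 0) => [->|ne]; first exact: Rabs_R0.
  by case: h; exists i.
have := pos _ cl nz; set y := ipR l a => y0.
have L0 := l1_ge0 a.
have e0 : (0 < y / (2 * (l1 a + 1)))%RR by apply: Rdiv_lt_0_compat; lra.
have [n0 [h1 h2]] := archimed_cor1 _ (Rlt_gt _ _ (Rdiv_lt_0_compat y 2 y0 ltac:(lra))).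
have [n /leP/le_INR nn hn] := lP _ n0 e0.
have : (y <= ipR (w n) a + y / (2 * (l1 a + 1)) * l1 a)%RR.
  by apply: ipR_lipschitz => i; rewrite Rabs_minus_sym; left; apply: hn.
have : (/ INR n.+1 <= / INR n0)%RR.
  apply: Rinv_le_contravar; first exact: lt_0_INR.
  by rewrite S_INR; lra.
have : (y / (2 * (l1 a + 1)) * (l1 a + 1) = y / 2)%RR by field; lra.
have := ipw n; lra.
Qed.

End Compactness.

(** * Counting values below a height *)

Section Counting.

Variables (d : nat) (a : 'I_d -> R) (delta : R).
Hypothesis delta0 : (0 < delta)%RR.

Notation vect := {ffun 'I_d -> Z}.

Definition in_strip (X : vect -> Prop) :=
  forall u, X u -> forall i, (delta * Rabs (IZR (u i)) <= ht a u)%RR.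

Lemma in_strip_ge0 X u : in_strip X -> X u -> (0 <= ht a u)%RR.
Proof.
move=> bX Xu; case: (pselect (exists i : 'I_d, True)) => [[i _]|no].
  by have := bX _ Xu i; have := Rabs_pos (IZR (u i)); nra.
by right; rewrite /ht /ipZ big1 // => i _; case: no; exists i.
Qed.

Definition radius (t : R) : nat := Z.to_nat (up (t / delta)).

Definition box (b : nat) : seq vect :=
  [seq [ffun i => (Z.of_nat (r i) - Z.of_nat b)%ZZ] | r : {ffun 'I_d -> 'I_(2 * b + 1)}].

Lemma box_uniq b : uniq (box b).
Proof.
rewrite map_inj_uniq ?enum_uniq // => r s /ffunP e; apply/ffunP => i; apply: val_inj.
by have /= := e i; rewrite !ffunE /=; lia.
Qed.

Definition shifted b (z : Z) : 'I_(2 * b + 1) :=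
  insubd (Ordinal (ltn_addl (2 * b) (ltnSn 0))) (Z.to_nat (z + Z.of_nat b)).

Lemma shiftedE b z : (- Z.of_nat b <= z <= Z.of_nat b)%ZZ ->
  Z.of_nat (shifted b z) = (z + Z.of_nat b)%ZZ.
Proof.
move=> h; rewrite /shifted val_insubd ifT; first lia.
by apply/ltP; rewrite -plusE -multE; lia.
Qed.

Lemma mem_box b (u : vect) : (forall i, (- Z.of_nat b <= u i <= Z.of_nat b)%ZZ) -> u \in box b.
Proof.
move=> h; apply/mapP.
exists [ffun i => shifted b (u i)]; first by rewrite mem_enum.
by apply/ffunP => i; rewrite !ffunE shiftedE //; exact: esym (Z.add_simpl_r _ _).
Qed.

(** For X in the strip the box contains every element of height less than t, so this list is
    complete; [mem_below] therefore assumes the strip. *)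
Definition below (X : vect -> Prop) (t : R) : seq vect :=
  [seq u <- box (radius t) | `[< X u /\ (ht a u < t)%RR >]].

Lemma below_uniq X t : uniq (below X t).
Proof. exact: filter_uniq (box_uniq _). Qed.

Lemma coord_le_radius (u : vect) t : (ht a u < t)%RR ->
  (forall i, (delta * Rabs (IZR (u i)) <= ht a u)%RR) ->
  forall i, (- Z.of_nat (radius t) <= u i <= Z.of_nat (radius t))%ZZ.
Proof.
move=> ut h i; have {h} := h i => h.
have [h1 _] := archimed (t / delta).
have h2 : (Rabs (IZR (u i)) < t / delta)%RR.
  apply: (Rmult_lt_reg_l delta) => //.
  by rewrite (_ : delta * (t / delta) = t)%RR; [lra|field; lra].
have h3 : (Z.abs (u i) < up (t / delta))%ZZ by apply: lt_IZR; rewrite abs_IZR; lra.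
by rewrite /radius; lia.
Qed.

Lemma mem_below X t u : in_strip X -> (u \in below X t) <-> X u /\ (ht a u < t)%RR.
Proof.
move=> bX; rewrite mem_filter; split; first by case/andP => /asboolP.
move=> uP; apply/andP; split; first exact/asboolP.
by case: uP => Xu ut; apply/mem_box/coord_le_radius => //; apply: bX.
Qed.

Definition cnt X t : nat := size (below X t).

Lemma size_le_cnt X t (l : seq vect) :
  in_strip X -> uniq l -> (forall u, u \in l -> X u /\ (ht a u < t)%RR) -> (size l <= cnt X t)%N.
Proof. by move=> bX ul lX; apply: uniq_leq_size => // u /lX /mem_below; apply. Qed.

Lemma cnt_mono X Y t t' : in_strip X -> in_strip Y ->
  (forall u, X u -> (ht a u < t)%RR -> Y u /\ (ht a u < t')%RR) -> (cnt X t <= cnt Y t')%N.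
Proof.
move=> bX bY XY; apply: size_le_cnt => //; first exact: below_uniq.
by move=> u /(mem_below _ _ bX)[]; apply: XY.
Qed.

Lemma cnt_shift X Y t w : in_strip X -> in_strip Y -> (forall u, X u -> Y (u + w)) ->
  (cnt X t <= cnt Y (t + ht a w)%RR)%N.
Proof.
move=> bX bY XY; rewrite -[cnt X t](size_map (fun u => u + w)).
apply: size_le_cnt => //.
  by rewrite map_inj_uniq ?below_uniq //; apply: addIr.
move=> _ /mapP[u /(mem_below _ _ bX)[Xu ut] ->]; split; first exact: XY.
by rewrite htD; lra.
Qed.

(** Division with remainder by k recovers u + w and r from the point, so the cubes of side k
    attached to distinct u are disjoint and each gives k^d points. Within a cube the height grows by
    at most k * [l1]. *)
Lemma cnt_scale X Y t k w : in_strip X -> in_strip Y -> (0 < k)%N ->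
  (forall u (r : vect), X u -> (forall i, (0 <= r i < Z.of_nat k)%ZZ) -> Y ((u + w) *+ k + r)) ->
  (k ^ d * cnt X t <= cnt Y (INR k * (t + (ht a w + l1 a)))%RR)%N.
Proof.
move=> bX bY k0 XY.
pose f (u : vect) (r : {ffun 'I_d -> 'I_k}) : vect :=
  (u + w) *+ k + [ffun i => Z.of_nat (r i)].
have rk (r : {ffun 'I_d -> 'I_k}) i :
    (0 <= [ffun i => Z.of_nat (r i)] i < Z.of_nat k)%ZZ.
  by rewrite ffunE; have /ltP := ltn_ord (r i); lia.
have -> : (k ^ d * cnt X t)%N =
    size [seq f u r | u <- below X t, r <- enum {: {ffun 'I_d -> 'I_k}}].
  by rewrite size_allpairs -cardE card_ffun !card_ord mulnC.
have k0' : (0 < INR k)%RR by apply: lt_0_INR; apply/ltP.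
apply: size_le_cnt => //; last first.
  move=> _ /allpairsP[[u r] /= [/(mem_below _ _ bX)[Xu ut] _ ->]]; split; first exact: XY.
  rewrite /f htD htMn htD; have := ht_lt_l1 a (rk r); nra.
apply: allpairs_uniq; [exact: below_uniq|exact: enum_uniq|].
have kz : (0 < Z.of_nat k)%ZZ by move/ltP: k0; lia.
have mulnZ (z : Z) : z *+ k = (Z.of_nat k * z)%ZZ.
  elim: (k) => [|j IH]; first by rewrite mulr0n.
  by rewrite mulrSr IH [LHS](_ : _ = (Z.of_nat j * z + z)%ZZ) //; lia.
move=> [u r] [v s] _ _ /= /ffunP e.
have uv i : u i = v i /\ r i = s i.
  have := rk r i; have := rk s i; have := e i; rewrite /f !ffunE !ffunMnE !ffunE !mulnZ.
  rewrite -![GRing.add _ _]/(Z.add _ _) => e1 sk rk'.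
  have [e2 e3] := Z.div_mod_unique _ _ _ _ _ (or_introl rk') (or_introl sk) e1.
  by split; [exact: (proj1 (Z.add_cancel_r _ _ (w i)))|apply/val_inj/Nat2Z.inj].
by congr (_, _); apply/ffunP => i; have [] := uv i.
Qed.

(* In the slab, u is determined by its coordinates other than the first and by its first
   coordinate modulo W + 1, because the height varies by less than (W + 1) |a_0|. *)
Lemma slab_size X t1 t2 W : in_strip X -> Qlin_indep a -> (0 < t1)%RR ->
  (forall i, (t2 - t1 < INR W.+1 * Rabs (a i))%RR) ->
  (size [seq u <- below X t2 | `[< (t1 <= ht a u)%RR >]] <=
     (2 * radius t2 + 1) ^ d.-1 * (W.+1 * (d != 0)))%N.
Proof.
move=> bX qa t1p hW; set l := filter _ _.
have lP u : u \in l ->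
    (forall i, (- Z.of_nat (radius t2) <= u i <= Z.of_nat (radius t2))%ZZ) /\
    (t1 <= ht a u < t2)%RR.
  rewrite mem_filter => /andP[/asboolP h /(mem_below _ _ bX)[Xu ut]].
  by split; [exact: (coord_le_radius ut (bX _ Xu))|split].
have ul : uniq l by apply: filter_uniq; apply: below_uniq.
clearbody l; move: (radius t2) lP => rad.
clear bX X; case: d a qa hW l ul => [|d'] a' qa hW l ul lP.
  (* For d = 0 every height is 0 < t1, so the slab is empty; the factor [d != 0] of the bound
     records this. *)
  case: l lP {ul} => [|u l] // lP.
  by have [_] := lP u (mem_head _ _); rewrite /ht /ipZ big_ord0; lra.
rewrite muln1 succnK.
pose f (u : {ffun 'I_d'.+1 -> Z}) : {ffun 'I_d' -> 'I_(2 * rad + 1)} * 'I_W.+1 :=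
  ([ffun j => shifted rad (u (lift ord0 j))],
   inord (Z.to_nat (u ord0 mod Z.of_nat W.+1))).
have W0 : (0 < Z.of_nat W.+1)%ZZ by lia.
have fi : {in l &, injective f}.
  move=> u v /lP[ub ut] /lP[vb vt] [/ffunP e0 e1].
  have el j : u (lift ord0 j) = v (lift ord0 j).
    have := e0 j; rewrite !ffunE => /(congr1 (fun i => Z.of_nat (val i))).
    by rewrite !shiftedE // => /Z.add_cancel_r.
  have em : (u ord0 mod Z.of_nat W.+1 = v ord0 mod Z.of_nat W.+1)%ZZ.
    move/(congr1 val): e1 => /=.
    have h1 := Z.mod_pos_bound (u ord0) _ W0.
    have h2 := Z.mod_pos_bound (v ord0) _ W0.
    have toN z : (0 <= z < Z.of_nat W.+1)%ZZ -> (Z.to_nat z < W.+1)%N.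
      by move=> ?; apply/ltP; lia.
    rewrite !inordK; [|exact: toN|exact: toN].
    by move/Z2Nat.inj => e; apply: e; [case: h1|case: h2].
  have hu : (ht a' u - ht a' v = (IZR (u ord0) - IZR (v ord0)) * a' ord0)%RR.
    rewrite /ht /ipZ !big_ord_recl.
    under eq_bigr do rewrite el.
    have idR x y z w : (x * z + w - (y * z + w) = (x - y) * z)%RR by ring.
    exact: idR.
  have lt : (Rabs (IZR (u ord0) - IZR (v ord0)) < INR W.+1)%RR.
    have : (Rabs (ht a' u - ht a' v) <= t2 - t1)%RR by rewrite /Rabs; case: Rcase_abs; lra.
    rewrite hu Rabs_mult => h2; have h1 := hW ord0.
    apply: Rnot_le_lt => h; have := Rmult_le_compat_r _ _ _ (Rabs_pos (a' ord0)) h.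
    by move: h1 h2 => /= h1 h2; lra.
  have {}lt : (Z.abs (u ord0 - v ord0) < Z.of_nat W.+1)%ZZ.
    by apply: lt_IZR; rewrite abs_IZR minus_IZR -INR_IZR_INZ.
  have h1 := Z.div_mod (u ord0) (Z.of_nat W.+1) ltac:(lia).
  have h2 := Z.div_mod (v ord0) (Z.of_nat W.+1) ltac:(lia).
  apply/ffunP => i; case: (unliftP ord0 i) => [j ->|->]; first exact: el.
  rewrite em in h1; move: h1 h2 lt W0.
  move: (u ord0) (v ord0) (Z.of_nat W.+1) => x y w.
  move: (x / w)%ZZ (y / w)%ZZ (y mod w)%ZZ => q1 q2 r -> -> lt W0.
  have : q1 = q2 by nia.
  by move->.
have := max_card (mem (map f l)).
rewrite (card_uniqP _) ?map_inj_in_uniq // size_map => h.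
by apply: leq_trans h _; rewrite card_prod card_ffun !card_ord.
Qed.

Lemma cnt_slab X t1 t2 : in_strip X ->
  (cnt X t2 <= cnt X t1 + size [seq u <- below X t2 | `[< (t1 <= ht a u)%RR >]])%N.
Proof.
move=> bX; rewrite /cnt -size_cat; apply: uniq_leq_size; first exact: below_uniq.
move=> u u2; rewrite mem_cat; apply/orP.
have [Xu _] := proj1 (mem_below _ _ bX) u2.
case: (Rlt_le_dec (ht a u) t1) => h; [left|right]; first exact/mem_below.
by rewrite mem_filter u2 (asboolT h).
Qed.

Lemma up_nat r : (0 <= r)%RR -> (r < INR (Z.to_nat (up r)) <= r + 1)%RR.
Proof.
move=> r0; have [h1 h2] := archimed r.
rewrite INR_IZR_INZ Z2Nat.id; first lra.
by apply: le_IZR; lra.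
Qed.

(** The count is of order t2^(d-1); multiplying it by t2 avoids the predecessor of d, so d = 0 fits
    the same formula. *)
Lemma cnt_slab_bound : Qlin_indep a ->
  exists2 K, (0 <= K)%RR & forall X t1 t2, in_strip X -> (0 < t1)%RR -> (t1 <= t2)%RR ->
    (1 <= t2)%RR ->
    ((INR (cnt X t2) - INR (cnt X t1)) * t2 <= K * (t2 - t1 + 1) * t2 ^ d)%RR.
Proof.
move=> qa.
have a0 i : (0 < Rabs (a i))%RR.
  apply: Rabs_pos_lt => ai.
  suff : (1 = 0)%ZZ by [].
  rewrite -[RHS](qa (fun j => if j == i then 1 else 0)%ZZ _ i) ?eqxx //.
  rewrite /ipZ (bigD1 i) //= eqxx ai big1; first lra.
  by move=> j /negbTE->; lra.
pose M := \big[Rplus/R0]_i (/ Rabs (a i))%RR.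
have iv i : (0 < / Rabs (a i))%RR by apply: Rinv_0_lt_compat.
have M0 : (0 <= M)%RR by apply: Rsum_ge0 => i; left.
have idl : (0 < / delta)%RR by apply: Rinv_0_lt_compat.
(* The side of the box is 2 * radius + 1 <= 2 * t2 / delta + 3, which is at most B * t2 because t2
   >= 1. *)
pose B := (2 * / delta + 3)%RR.
have K0 : (0 <= B ^ d.-1 * (M + 2))%RR.
  by apply: Rmult_le_pos; [apply: pow_le; rewrite /B|]; lra.
exists (B ^ d.-1 * (M + 2))%RR => // X t1 t2 bX t10 t12 t21.
(* [M] dominates every 1 / |a_i|, so W + 1 residues suffice and their number is linear in the width
   of the slab. *)
pose W := Z.to_nat (up ((t2 - t1) * M)).
have [hW1 hW2] : ((t2 - t1) * M < INR W <= (t2 - t1) * M + 1)%RR by apply: up_nat; nra.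
have hW i : (t2 - t1 < INR W.+1 * Rabs (a i))%RR.
  have := Rsum_term i (fun j => Rlt_le _ _ (iv j)); rewrite -/M => Mi.
  rewrite S_INR; have := iv i; have ai := a0 i => iai.
  have e : (/ Rabs (a i) * Rabs (a i) = 1)%RR by apply: Rinv_l; lra.
  have h : ((t2 - t1) * / Rabs (a i) <= (t2 - t1) * M)%RR by apply: Rmult_le_compat_l; lra.
  have : ((t2 - t1) * / Rabs (a i) * Rabs (a i) < (INR W + 1) * Rabs (a i))%RR.
    by apply: Rmult_lt_compat_r; lra.
  by rewrite Rmult_assoc e; lra.
have := slab_size bX qa t10 hW.
have := cnt_slab t1 t2 bX; set sl := size _ => h1 h2.
have [r1 r2] : (t2 / delta < INR (radius t2) <= t2 / delta + 1)%RR.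
  by apply: up_nat; rewrite /Rdiv; nra.
have {h1} : (INR (cnt X t2) - INR (cnt X t1) <= INR sl)%RR.
  by move/leP/le_INR: h1; rewrite plus_INR; lra.
move/leP/le_INR: h2; case: (posnP d) => [->|d0].
  by rewrite muln0 muln0 /= => h1 h2; nra.
rewrite muln1 -multE mult_INR => h1 h2.
have hB : (INR ((2 * radius t2 + 1) ^ d.-1) <= B ^ d.-1 * t2 ^ d.-1)%RR.
  rewrite -Rpow_mult_distr.
  have -> : INR ((2 * radius t2 + 1) ^ d.-1) = (INR (2 * radius t2 + 1) ^ d.-1)%RR.
    by elim: d.-1 => [|j IH] //; rewrite expnS -multE mult_INR IH.
  apply: pow_incr; split; first exact: pos_INR.
  rewrite -plusE -multE plus_INR mult_INR /B; move: r2; rewrite /Rdiv /=; nra.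
have hW' : (INR W.+1 <= (M + 2) * (t2 - t1 + 1))%RR by rewrite S_INR; nra.
have -> : (t2 ^ d = t2 ^ d.-1 * t2)%RR by case: (d) d0 => [|j] // _ /=; ring.
have tp : (0 <= t2 ^ d.-1)%RR by apply: pow_le; lra.
have : (INR sl <= (B ^ d.-1 * t2 ^ d.-1) * ((M + 2) * (t2 - t1 + 1)))%RR.
  apply: Rle_trans h1 _; apply: Rmult_le_compat => //; exact: pos_INR.
move=> h3; have {h3 h2} : (INR (cnt X t2) - INR (cnt X t1) <=
  (B ^ d.-1 * t2 ^ d.-1) * ((M + 2) * (t2 - t1 + 1)))%RR by lra.
by move/(Rmult_le_compat_r t2 _ _ ltac:(lra)) => h; nra.
Qed.

Lemma cnt_slab_density N M : Qlin_indep a -> (0 < N)%RR -> (0 < M)%RR ->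
  exists2 K, (0 <= K)%RR & forall X Q t1 t2, in_strip X -> (0 < Q)%RR ->
    (0 < t1)%RR -> (t1 <= t2)%RR -> (1 <= t2)%RR -> (N * Q <= t2 <= M * Q)%RR ->
    (INR (cnt X t2) - INR (cnt X t1) <= K * (t2 - t1 + 1) / Q * Q ^ d)%RR.
Proof.
move=> qa N0 M0; have [K K0 hK] := cnt_slab_bound qa.
have Md : (0 < M ^ d)%RR by apply: pow_lt.
have iN : (0 < / N)%RR by apply: Rinv_0_lt_compat.
have K'0 : (0 <= K * M ^ d * / N)%RR by apply: Rmult_le_pos; [apply: Rmult_le_pos|]; lra.
exists (K * M ^ d * / N)%RR => // X Q t1 t2 bX Q0 t10 t12 t21 [tN tM].
have h := hK X t1 t2 bX t10 t12 t21.
have hp : (t2 ^ d <= M ^ d * Q ^ d)%RR by rewrite -Rpow_mult_distr; apply: pow_incr; lra.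
have Qd : (0 < Q ^ d)%RR by apply: pow_lt.
set D := (_ - _)%RR in h *.
case: (Rle_lt_dec D 0) => D0.
  apply: Rle_trans D0 _; apply: Rmult_le_pos; last lra.
  apply: Rmult_le_pos; last by left; apply: Rinv_0_lt_compat.
  by apply: Rmult_le_pos; lra.
have h2 : (D * (N * Q) <= K * (t2 - t1 + 1) * (M ^ d * Q ^ d))%RR.
  have h3 : (D * (N * Q) <= D * t2)%RR by apply: Rmult_le_compat_l; lra.
  apply: Rle_trans h3 _; apply: Rle_trans h _; apply: Rmult_le_compat_l => //; apply: Rmult_le_pos; lra.
apply: (Rmult_le_reg_r (N * Q)); first exact: Rmult_lt_0_compat.
apply: Rle_trans h2 _; right; field; lra.
Qed.

(** The slab estimate is used from height 1 upwards; below height 1 the box bounds the count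
    independently of X, so one B serves a whole family of sets. *)
Lemma cnt_bounded N : Qlin_indep a -> (0 < N)%RR ->
  exists B, forall X Q, in_strip X -> (1 <= N * Q)%RR -> (1 <= Q)%RR ->
    (INR (cnt X (N * Q)) <= B * Q ^ d)%RR.
Proof.
move=> qa N0; have [K K0 hK] := cnt_slab_density qa N0 N0.
exists (K * N + INR (size (box (radius 1))))%RR => X Q bX NQ Q1.
have h1 : (INR (cnt X 1) <= INR (size (box (radius 1))))%RR.
  by apply/le_INR/leP; rewrite /cnt size_filter; apply: count_size.
have := hK X Q 1%RR (N * Q)%RR bX ltac:(lra) ltac:(lra) NQ NQ ltac:(lra).
have -> : (K * (N * Q - 1 + 1) / Q = K * N)%RR by field; lra.
have : (1 <= Q ^ d)%RR by apply: pow_R1_Rle.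
have := pos_INR (size (box (radius 1))); nra.
Qed.

End Counting.

(** * Convergence of normalised counts along powers of p *)

Section Limits.

(** The limit is the limsup, that is, the supremum of [S]: eventually y e < L + eps, and once a late
    enough term exceeds L - eps / 2 the hypothesis keeps all later ones above L - eps. *)
Lemma almost_increasing_cv (y : nat -> R) B : (forall e, (y e <= B)%RR) ->
  (forall eps, (0 < eps)%RR ->
     exists E, forall e k, (E <= e)%N -> (y e - eps <= y (e + k)%N)%RR) ->
  exists L, Un_cv y L.
Proof.
move=> yB inc.
pose S x := forall n, exists2 e, (n <= e)%N & (x <= y e)%RR.
have SB : bound S by exists B => x /(_ 0%N)[e _ h]; have := yB e; lra.
have [|L [Lub Llub]] := completeness S SB.
  have [E hE] := inc 1%RR ltac:(lra).
  by exists (y E - 1)%RR => n; exists (E + n)%N; [rewrite leq_addl|exact: hE].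
exists L => eps eps0.
have [n0 hn0] : exists n, forall e, (n <= e)%N -> (y e < L + eps)%RR.
  apply: NNPP => no; suff : S (L + eps)%RR by move/Lub; lra.
  move=> n; apply: NNPP => no'; apply: no; exists n => e ne.
  by apply: Rnot_le_lt => h; apply: no'; exists e.
have [E hE] := inc (eps / 2)%RR ltac:(lra).
have [x Sx xL] : exists2 x, S x & (L - eps / 2 < x)%RR.
  apply: NNPP => no; suff : (L <= L - eps / 2)%RR by lra.
  by apply: Llub => x Sx; apply: Rnot_lt_le => h; apply: no; exists x.
have [e0 Ee0 xe0] := Sx E.
exists (e0 + n0)%N => n /leP nn; rewrite /R_dist.
have := hn0 n (leq_trans (leq_addl _ _) nn).
have := hE e0 (n - e0)%N Ee0; rewrite subnKC; last exact: leq_trans (leq_addr _ _) nn.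
by rewrite /Rabs; case: Rcase_abs; lra.
Qed.

Variable p : nat.
Hypothesis p1 : (1 < p)%N.

Definition ppow e : R := INR (p ^ e).
Local Notation Q := ppow.

Lemma ppow_add e k : Q (e + k) = (Q e * Q k)%RR.
Proof. by rewrite /ppow expnD -multE mult_INR. Qed.

Lemma ppow_ge1 e : (1 <= Q e)%RR.
Proof. by apply: (le_INR 1); apply/leP; rewrite expn_gt0; case: p p1. Qed.

Lemma ppow_large M : exists E, forall e, (E <= e)%N -> (M <= Q e)%RR.
Proof.
exists (Z.to_nat (up M)) => e Ee.
case: (Rle_lt_dec M 0) => M0; first by have := ppow_ge1 e; lra.
have [h1 h2] := up_nat (Rlt_le _ _ M0).
have : (Z.to_nat (up M) <= p ^ e)%N by apply: leq_trans Ee (ltnW (ltn_expl _ p1)).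
by move/leP/le_INR; rewrite -/(Q e); lra.
Qed.

Lemma ppow_inv_small C eps : (0 < eps)%RR -> exists E, forall e, (E <= e)%N -> (C / Q e <= eps)%RR.
Proof.
move=> eps0; have [E hE] := ppow_large (C / eps); exists E => e /hE h.
have := ppow_ge1 e => Q1; apply: (Rmult_le_reg_r (Q e)); first lra.
have -> : (C / Q e * Q e = C / eps * eps)%RR by field; lra.
nra.
Qed.

Variables (d : nat) (a : 'I_d -> R) (delta : R).
Hypothesis (delta0 : (0 < delta)%RR) (qa : Qlin_indep a).
Notation vect := {ffun 'I_d -> Z}.
Local Notation in_strip := (in_strip a delta).
Local Notation cnt := (cnt a delta).

Lemma cnt_cv (X : nat -> vect -> Prop) (w : vect) N :
  (forall e, in_strip (X e)) -> (0 < N)%RR -> (0 <= ht a w)%RR ->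
  (forall e k u (r : vect), X e u -> (forall i, (0 <= r i < Z.of_nat (p ^ k))%ZZ) ->
     X (e + k)%N ((u + w) *+ (p ^ k) + r)) ->
  exists L, Un_cv (fun e => (INR (cnt (X e) (N * Q e)) / Q e ^ d)%RR) L.
Proof.
move=> bX N0 w0 XX; pose y e := (INR (cnt (X e) (N * Q e)) / Q e ^ d)%RR; rewrite -/y.
have [B hB] := cnt_bounded delta0 qa N0.
have [K K0 hK] := cnt_slab_density delta0 qa N0 N0.
have [E0 hE0] := ppow_large (/ N).
have NQ e : (E0 <= e)%N -> (1 <= N * Q e)%RR.
  move/hE0/(Rmult_le_compat_l N _ _ (Rlt_le _ _ N0)); rewrite Rinv_r; lra.
have Qd e : (0 < Q e ^ d)%RR by apply: pow_lt; have := ppow_ge1 e; lra.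
have [|eps eps0|L yL] := @almost_increasing_cv (fun e => y (E0 + e)%N) B.
- move=> e; apply: (Rmult_le_reg_r (Q (E0 + e) ^ d)) => //.
  rewrite /y /Rdiv Rmult_assoc Rinv_l; last by have := Qd (E0 + e)%N; lra.
  rewrite Rmult_1_r; apply: hB => //; last exact: ppow_ge1.
  by apply: NQ; apply: leq_addr.
(* Scaling starts from height N Q f - c, so that the cubes end below N Q (f + k). Only a slab of
   fixed width c is given up, and its share is O(1 / Q f). *)
- pose c := (ht a w + l1 a)%RR; have c0 : (0 <= c)%RR by have := l1_ge0 a; rewrite /c; lra.
  have [E1 hE1] := ppow_inv_small (K * (c + 1)) eps0.
  have [E2 hE2] := ppow_large ((c + 1) / N).
  exists (E1 + E2)%N => e k Ee; rewrite addnA; set f := (E0 + e)%N.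
  have h1 : (K * (c + 1) / Q f <= eps)%RR.
    apply: hE1; apply: leq_trans (leq_addl E0 e); exact: leq_trans (leq_addr _ _) Ee.
  have h2 : (c + 1 <= N * Q f)%RR.
    have : ((c + 1) / N <= Q f)%RR.
      apply: hE2; apply: leq_trans (leq_addl E0 e); exact: leq_trans (leq_addl _ _) Ee.
    move/(Rmult_le_compat_l N _ _ (Rlt_le _ _ N0)).
    by rewrite (_ : N * ((c + 1) / N) = c + 1)%RR //; field; lra.
  have Qf := ppow_ge1 f.
  have := hK (X f) (Q f) (N * Q f - c)%RR (N * Q f)%RR (bX f) ltac:(lra) ltac:(lra)
    ltac:(lra) ltac:(lra) ltac:(lra).
  have -> : (N * Q f - (N * Q f - c) + 1 = c + 1)%RR by ring.
  have pk : (0 < p ^ k)%N by rewrite expn_gt0; case: p p1.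
  have := cnt_scale delta0 (N * Q f - c)%RR (bX f) (bX (f + k)%N) pk (XX f k).
  have -> : (INR (p ^ k) * (N * Q f - c + (ht a w + l1 a)) = N * Q (f + k))%RR.
    by rewrite ppow_add -/c -/(Q k); ring.
  move/leP/le_INR; rewrite -multE mult_INR.
  have -> : INR ((p ^ k) ^ d) = (Q k ^ d)%RR.
    by elim: (d) => [|j IH] //; rewrite expnS -multE mult_INR IH.
  rewrite /y; set A1 := INR _; set A2 := INR _; set A3 := INR _ => h3 h4.
  have h5 : (A3 - A1 <= eps * Q f ^ d)%RR by have := Qd f; nra.
  rewrite ppow_add Rpow_mult_distr; apply: (Rmult_le_reg_r (Q f ^ d * Q k ^ d)).
    exact: Rmult_lt_0_compat.
  have [Qf' Qk] := (Qd f, Qd k).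
  have -> : ((A3 / Q f ^ d - eps) * (Q f ^ d * Q k ^ d) =
      Q k ^ d * (A3 - eps * Q f ^ d))%RR by field; lra.
  have -> : (A2 / (Q f ^ d * Q k ^ d) * (Q f ^ d * Q k ^ d) = A2)%RR by field; lra.
  nra.
exists L => eps /yL[n hn]; exists (E0 + n)%N => m /leP mn.
by rewrite -(subnKC (leq_trans (leq_addr _ _) mn)); apply: hn; lia.
Qed.

End Limits.

(** * The filtration of the fraction field *)

Section Fractions.
Local Open Scope quotient_scope.

Lemma frac_denom (A : idomainType) (x : {fraction A}) :
  exists2 b : A, b != 0 & exists c, tofrac b * x = tofrac c.
Proof.
elim/quotW: x => x; exists (frac x).2; first exact: denom_ratioP.
exists (frac x).1; have dx := denom_ratioP x.
unlock tofrac; rewrite -[LHS]FracField.pi_mul.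
apply/eqP; rewrite FracField.equivf_def /FracField.mulf !numden_Ratio ?oner_neq0 ?mul1r //.
by rewrite mulr1 mulrC.
Qed.

Lemma frac_common_denom (A : idomainType) (s : seq {fraction A}) :
  exists2 b : A, b != 0 & exists cs, map ( *%R (tofrac b)) s = map (@tofrac A) cs.
Proof.
elim: s => [|x s [b b0 [cs e]]]; first by exists 1; [exact: oner_neq0|exists [::]].
have [b' b'0 [c e']] := frac_denom x.
exists (b' * b); first by rewrite mulf_neq0.
exists (b * c :: map ( *%R b') cs) => /=; congr (_ :: _).
  by rewrite !tofracM -e' mulrCA mulrA.
rewrite -map_comp (eq_map (g := (fun y => tofrac b' * y) \o ( *%R (tofrac b)))).
  by rewrite map_comp e -map_comp; apply: eq_map => y /=; rewrite tofracM.
by move=> y /=; rewrite tofracM mulrA.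
Qed.

End Fractions.

Lemma exists_max (P : nat -> Prop) B : (exists n, P n) -> (forall n, P n -> (n <= B)%N) ->
  exists2 n, P n & forall k, P k -> (k <= n)%N.
Proof.
move=> [n0 P0] PB; have ex : exists n, `[< P n >] by exists n0; apply/asboolP.
have ub n : `[< P n >] -> (n <= B)%N by move/asboolP/PB.
case: (ex_maxnP ex ub) => n /asboolP Pn h; exists n => // k Pk.
by apply: h; apply/asboolP.
Qed.

(** * Linear algebra over k in the graded pieces of the fraction field *)

Section Valuation.

Import mathcomp.algebra_tactics.ring.

Variables (A : idomainType) (m : A -> Prop) (d : nat) (a : 'I_d -> R).
Variable nu : {fraction A} -> 'I_d -> Z.
Hypotheses (loc : is_local m) (ok : OK_relative m a nu) (qa : Qlin_indep a).

Local Notation F := {fraction A}.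
Local Notation "x %:F" := (@tofrac A x).
Implicit Types (x y z : F) (ys : seq F) (r c : A) (s t : R).

Definition vec x : {ffun 'I_d -> Z} := [ffun i => nu x i].
Definition hgt x : R := ht a (vec x).

Lemma ipZ_nu x : ipZ (nu x) a = hgt x.
Proof. by rewrite /hgt /ht /ipZ; apply: eq_bigr => i _; rewrite ffunE. Qed.

Lemma vecM x y : x != 0 -> y != 0 -> vec (x * y) = vec x + vec y.
Proof.
by case: ok => -[nuM _] _ x0 y0; apply/ffunP => i; rewrite !ffunE nuM.
Qed.

Lemma hgtM x y : x != 0 -> y != 0 -> hgt (x * y) = (hgt x + hgt y)%RR.
Proof. by move=> x0 y0; rewrite /hgt vecM // htD. Qed.

Lemma vec1 : vec 1 = 0.
Proof.
have := vecM (oner_neq0 F) (oner_neq0 F); rewrite mulr1.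
by move=> /esym/(canRL (addrK _)); rewrite subrr.
Qed.

Lemma hgt1 : hgt 1 = 0%RR.
Proof. by rewrite /hgt vec1 ht0. Qed.

Lemma vecX x k : x != 0 -> vec (x ^+ k) = vec x *+ k.
Proof.
move=> x0; elim: k => [|k IH]; first by rewrite expr0 vec1.
by rewrite exprS mulrS vecM ?expf_neq0 // IH.
Qed.

Lemma hgtV x : x != 0 -> hgt x^-1 = (- hgt x)%RR.
Proof.
by move=> x0; have := hgtM x0 (invr_neq0 x0); rewrite divff // hgt1; lra.
Qed.

Lemma hgtN x : hgt (- x) = hgt x.
Proof.
case: (eqVneq x 0) => [->|x0]; first by rewrite oppr0.
have n1 : (-1 : F) != 0 by rewrite oppr_eq0 oner_neq0.
rewrite -mulN1r hgtM //; have := hgtM n1 n1; rewrite mulrNN mulr1 hgt1; lra.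
Qed.

Lemma hgtD x y : x != 0 -> y != 0 -> x + y != 0 -> (Rmin (hgt x) (hgt y) <= hgt (x + y)%R)%RR.
Proof.
case: ok => -[_ [_ nuD]] _ x0 y0 xy0; rewrite -!ipZ_nu; exact: nuD.
Qed.

Lemma vec_surj u : exists2 x, x != 0 & vec x = u.
Proof.
case: ok => -[_ [sur _]] _; have [x [x0 xu]] := sur u.
by exists x => //; apply/ffunP => i; rewrite ffunE.
Qed.

Definition vge t x := x = 0 \/ (t <= hgt x)%RR.
Definition vgt t x := x = 0 \/ (t < hgt x)%RR.

Lemma vgtW t x : vgt t x -> vge t x.
Proof. by case=> [->|lt]; [left|right; lra]. Qed.

Lemma vge_lt s t x : (s < t)%RR -> vge t x -> vgt s x.
Proof. by move=> st [->|le]; [left|right; lra]. Qed.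

Lemma vge_le s t x : (s <= t)%RR -> vge t x -> vge s x.
Proof. by move=> st [->|le]; [left|right; lra]. Qed.

Lemma vge_add t x y : vge t x -> vge t y -> vge t (x + y).
Proof.
case: (eqVneq x 0) => [->|x0]; first by rewrite add0r.
case: (eqVneq y 0) => [->|y0]; first by rewrite addr0.
case: (eqVneq (x + y) 0) => [->|xy0]; first by left.
move=> [/eqP|hx]; first by rewrite (negbTE x0).
move=> [/eqP|hy]; first by rewrite (negbTE y0).
by right; apply: Rle_trans (hgtD x0 y0 xy0); apply: Rmin_glb.
Qed.

Lemma vgt_add t x y : vgt t x -> vgt t y -> vgt t (x + y).
Proof.
case: (eqVneq x 0) => [->|x0]; first by rewrite add0r.
case: (eqVneq y 0) => [->|y0]; first by rewrite addr0.
case: (eqVneq (x + y) 0) => [->|xy0]; first by left.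
move=> [/eqP|hx]; first by rewrite (negbTE x0).
move=> [/eqP|hy]; first by rewrite (negbTE y0).
by right; apply: Rlt_le_trans (hgtD x0 y0 xy0); apply: Rmin_glb_lt.
Qed.

Lemma vge_opp t x : vge t x -> vge t (- x).
Proof. by case=> [->|hx]; [rewrite oppr0; left|right; rewrite hgtN]. Qed.

Lemma vge_mul s t x y : vge s x -> vge t y -> vge (s + t)%RR (x * y).
Proof.
case: (eqVneq x 0) => [->|x0]; first by rewrite mul0r; left.
case: (eqVneq y 0) => [->|y0]; first by rewrite mulr0; left.
move=> [/eqP|hx]; first by rewrite (negbTE x0).
move=> [/eqP|hy]; first by rewrite (negbTE y0).
by right; rewrite hgtM //; lra.
Qed.

Lemma vgt_mul s t x y : vge s x -> vgt t y -> vgt (s + t)%RR (x * y).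
Proof.
case: (eqVneq x 0) => [->|x0]; first by rewrite mul0r; left.
case: (eqVneq y 0) => [->|y0]; first by rewrite mulr0; left.
move=> [/eqP|hx]; first by rewrite (negbTE x0).
move=> [/eqP|hy]; first by rewrite (negbTE y0).
by right; rewrite hgtM //; lra.
Qed.

Lemma vge0_tofrac r : vge 0 (r%:F).
Proof. by case: ok => _ [/(_ r) [|]]; [left|right; rewrite -ipZ_nu]. Qed.

Lemma max_ideal_vgt r : m r <-> vgt 0 (r%:F).
Proof.
case: ok => _ [_ [mV _]]; rewrite mV /inmV /vgt ipZ_nu; tauto.
Qed.

Lemma vge_smul r t x : vge t x -> vge t (r%:F * x).
Proof. by move/(vge_mul (vge0_tofrac r)); rewrite Rplus_0_l. Qed.

Lemma vgt_smul r t x : vgt t x -> vgt t (r%:F * x).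
Proof. by move/(vgt_mul (vge0_tofrac r)); rewrite Rplus_0_l. Qed.

Lemma unit_of_notin r : ~ m r -> exists r', r' * r = 1.
Proof. by case: loc => _ [_ h] /h u; exists r^-1; rewrite mulVr. Qed.

(* [inspan t ys x]: x lies in the R-span of ys modulo F_(> t).  As m F_(>= t) is contained
   in F_(> t), [vfree t ys] is linear independence over the residue field k in
   F_(>= t) / F_(> t): no vector is in the span of the later ones. *)
Fixpoint inspan t ys x : Prop :=
  if ys is y :: ys' then exists c : A, inspan t ys' (x - c%:F * y) else vgt t x.

Fixpoint vfree t ys : Prop :=
  if ys is y :: ys' then vge t y /\ ~ inspan t ys' y /\ vfree t ys' else True.

Lemma inspan_gt t ys x : vgt t x -> inspan t ys x.
Proof.
by elim: ys x => [|y ys IH] x //= gx; exists 0; rewrite tofrac0 mul0r subr0; apply: IH.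
Qed.

Lemma inspan_add t ys x y : inspan t ys x -> inspan t ys y -> inspan t ys (x + y).
Proof.
elim: ys x y => [|z ys IH] x y /=; first exact: vgt_add.
move=> [c hc] [c' hc']; exists (c + c'); have := IH _ _ hc hc'.
by congr (inspan _ _ _); rewrite tofracD; ring.
Qed.

Lemma inspan_smul t ys r x : inspan t ys x -> inspan t ys (r%:F * x).
Proof.
elim: ys x => [|z ys IH] x /=; first exact: vgt_smul.
move=> [c hc]; exists (r * c); have := IH _ hc.
by congr (inspan _ _ _); rewrite tofracM; ring.
Qed.

Lemma inspan_opp t ys x : inspan t ys x -> inspan t ys (- x).
Proof.
by move/(inspan_smul (-1)); rewrite tofracN tofrac1 mulN1r.
Qed.

Lemma inspan_sub t ys x y : inspan t ys x -> inspan t ys y -> inspan t ys (x - y).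
Proof. by move=> hx /inspan_opp; apply: inspan_add. Qed.

Lemma inspan_cons t y ys x : inspan t ys x -> inspan t (y :: ys) x.
Proof. by exists 0; rewrite tofrac0 mul0r subr0. Qed.

Lemma inspan_scale t z ys x : z != 0 ->
  inspan t ys x -> inspan (t + hgt z)%RR (map ( *%R z) ys) (z * x).
Proof.
move=> z0; elim: ys x => [|y ys IH] x /=.
  by move/(vgt_mul (s := hgt z)); rewrite Rplus_comm; apply; right; lra.
move=> [c /IH hc]; exists c; move: hc.
by congr (inspan _ _ _); ring.
Qed.

Lemma free_scale t z ys : z != 0 -> vfree t ys -> vfree (t + hgt z)%RR (map ( *%R z) ys).
Proof.
move=> z0; elim: ys => [|y ys IH] //= [gy [ny fy]]; split.
  by rewrite Rplus_comm; apply: vge_mul => //; right; lra.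
split; last exact: IH.
move/(inspan_scale (invr_neq0 z0)); rewrite mulKf // -map_comp hgtV //.
rewrite (_ : t + hgt z + - hgt z = t)%RR; last lra.
by rewrite (eq_map (g := id)) ?map_id // => x /=; rewrite mulKf.
Qed.

Lemma inspan_ge t ys x : (forall y, y \in ys -> vge t y) -> inspan t ys x -> vge t x.
Proof.
elim: ys x => [|y ys IH] x gys /=; first exact: vgtW.
move=> [c hc]; rewrite -[x](subrK (c%:F * y)); apply: vge_add.
  by apply: IH hc => z zy; apply: gys; rewrite inE zy orbT.
by apply: vge_smul; apply: gys; rewrite inE eqxx.
Qed.

Lemma free_ge t ys : vfree t ys -> forall y, y \in ys -> vge t y.
Proof.
elim: ys => [|y ys IH] //= [gy [_ /IH fy]] x; rewrite inE => /orP[/eqP->|] //.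
exact: fy.
Qed.

Lemma inspan_closed t ys x (J : A -> Prop) : is_ideal J ->
  (forall y, y \in ys -> exists2 r, J r & y = r%:F) ->
  inspan t ys x -> exists2 r, J r & vgt t (x - r%:F).
Proof.
move=> [J0 [JD JM]]; elim: ys x => [|y ys IH] x Jys /=.
  by move=> gx; exists 0 => //; rewrite tofrac0 subr0.
move=> [c /IH[|r Jr gr]].
  by move=> z zy; apply: Jys; rewrite inE zy orbT.
have [r' Jr' e] := Jys y (mem_head _ _).
exists (c * r' + r); first by apply: JD => //; apply: JM.
by rewrite tofracD opprD addrA tofracM -e.
Qed.

(* Elimination of the first spanning vector: either it is not needed to span ys,
   or one element z of ys with a unit coefficient can be traded for it. *)
Lemma exchange t z0 zs ys : vge t z0 ->
  (forall y, y \in ys -> inspan t (z0 :: zs) y) -> vfree t ys ->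
  (forall y, y \in ys -> inspan t zs y) \/
  exists z ys', [/\ size ys = (size ys').+1, vfree t ys',
    (forall y, y \in ys' -> inspan t zs y),
    (vge t z /\ forall x, inspan t (z0 :: zs) x -> exists r, inspan t zs (x - r%:F * z)) &
    forall x r, inspan t ys' (x - r%:F * z) -> inspan t ys x].
Proof.
move=> gz0; elim: ys => [|y ys IH] sp /=; first by left.
move=> [gy [ny fy]].
case: IH => // [x xy|all|[z [ys' [sz fys' sp' [gz ex] back]]]].
- by apply: sp; rewrite inE xy orbT.
- case: (pselect (inspan t zs y)) => ysp.
    by left=> x; rewrite inE => /orP[/eqP->|/all].
  right; exists y, ys; split=> //; last by move=> x r hr; exists r.
  split=> // x [c hc].
  have [c' hc'] := sp y (mem_head _ _).
  (* If c' were in m, then c' z0 would lie in F_(> t), and y would already be in the span of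
     [zs]. *)
  have [u uc'] : exists u, u * c' = 1.
    apply: unit_of_notin => /max_ideal_vgt mc'; apply: ysp; rewrite -(subrK (c'%:F * z0) y).
    apply: inspan_add hc' _; apply: inspan_gt.
    by rewrite mulrC -[t]Rplus_0_r; apply: vgt_mul.
  exists (c * u); have := inspan_sub hc (inspan_smul (c * u) hc').
  congr (inspan _ _ _).
  have -> : c%:F = (c * u)%:F * c'%:F by rewrite -tofracM -mulrA uc' mulr1.
  by ring.
(* The new vector y is made independent of z0 by subtracting a multiple of z. The clause [back]
   turns a relation among the reduced vectors into one among the original [ys], which keeps the
   reduced family free. *)
- right; have [r hr] := ex y (sp y (mem_head _ _)).
  exists z, ((y - r%:F * z) :: ys'); split=> //=.
  + by rewrite sz.
  + split; first by apply: vge_add => //; apply/vge_opp/vge_smul.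
    by split=> // /back.
  + by move=> x; rewrite inE => /orP[/eqP->|/sp'].
  + move=> x r' [c hc]; exists c; apply: (back _ (r' - c * r)); move: hc.
    by congr (inspan _ _ _); rewrite tofracB tofracM; ring.
Qed.

(** By [exchange], removing one spanning vector costs at most one free vector. With no spanning
    vector left, a member of [ys] would lie in F_(> t), hence in every span, against freeness. *)
Lemma steinitz t zs ys : (forall z, z \in zs -> vge t z) ->
  (forall y, y \in ys -> inspan t zs y) -> vfree t ys -> (size ys <= size zs)%N.
Proof.
elim: zs ys => [|z0 zs IH] ys gz sp fy.
  case: ys sp fy => [|y ys] // sp /= [_ [[]]].
  exact: inspan_gt (sp y (mem_head _ _)).
have gzs z : z \in zs -> vge t z by move=> zz; apply: gz; rewrite inE zz orbT.
case: (exchange (gz z0 (mem_head _ _)) sp fy) => [all|].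
  exact: leqW (IH _ gzs all fy).
by move=> [z [ys' [-> fys' sp' _ _]]] /=; rewrite ltnS; apply: IH.
Qed.

(** [f] is [k_V : k]. The generators from (iii) and [steinitz] bound free families at height 0, and
    division by z carries a family at height hgt z to height 0. The family [[:: 1]] makes f
    positive. *)
Lemma residue_dim : exists f, (0 < f)%N /\ (exists2 ys, vfree 0 ys & size ys = f) /\
  forall z ys, z != 0 -> vfree (hgt z) ys -> (size ys <= f)%N.
Proof.
case: ok => _ [_ [_ [_ [[zs [gzs gen]] _]]]].
have inVge x : inV a nu x <-> vge 0 x by rewrite /inV ipZ_nu.
have gzs' z : z \in zs -> vge 0 z.
  elim: zs gzs {gen} => [|w zs IH] // H; inversion_clear H as [|? ? wge zsge].
  by rewrite inE => /orP[/eqP->|/(IH zsge)] //; apply/inVge.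
have sp x : vge 0 x -> inspan 0 zs x.
  move/inVge/gen => [cs [_]]; rewrite /inmV ipZ_nu -/(vgt 0 _).
  elim: zs x cs {gzs gen gzs'} => [|z zs IH] x cs /=.
    by rewrite big_ord0 subr0.
  rewrite big_ord_recl /= opprD addrA => gx; exists (nth 0 cs 0).
  apply: (IH _ (behead cs)); move: gx; congr (vgt _ (_ - _)).
  by apply: eq_bigr => i _; rewrite /bump /= add1n -nth_behead.
have bnd ys : vfree 0 ys -> (size ys <= size zs)%N.
  by move=> fy; apply: (steinitz gzs' _ fy) => y /(free_ge fy)/sp.
have fr1 : vfree 0 [:: 1 : F].
  split; first by right; rewrite hgt1; lra.
  by split=> // -[/eqP|]; rewrite ?oner_eq0 ?hgt1 //; lra.
have [||f [ys fy sf] maxf] :=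
  @exists_max (fun n => exists2 ys, vfree 0 ys & size ys = n) (size zs).
- by exists 1%N; exists [:: 1].
- by move=> n [ys fy <-]; apply: bnd.
exists f; split; first by apply: maxf; exists [:: 1].
split; first by exists ys.
move=> z xs z0 /(free_scale (invr_neq0 z0)); rewrite hgtV // Rplus_opp_r => fx.
by apply: maxf; exists (map ( *%R z^-1) xs) => //; rewrite size_map.
Qed.

End Valuation.

(** * Colength and counting of values *)

(** The pigeonhole principle, used both for steps of a chain sorted by value and for factors of a
    monomial. *)
Lemma size_le_sum_count (T K : eqType) (key : T -> K) (L : seq K) (l : seq T) :
  {in l, forall x, key x \in L} ->
  (size l <= \sum_(u <- L) count (fun x => key x == u) l)%N.
Proof.
elim: l => [|x l IH] lL //=; rewrite big_split /= -add1n; apply: leq_add; last first.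
  by apply: IH => y yl; apply: lL; rewrite inE yl orbT.
by rewrite (big_rem (key x)) /= ?eqxx ?lL ?mem_head.
Qed.

Section Chains.

Variable A : idomainType.
Implicit Types (I J : A -> Prop).

(** The chain ends inside J rather than at J, so it can be continued through mere inclusions and no
    equality of ideals is ever needed. *)
Definition reach I n J := exists c : nat -> A -> Prop,
  [/\ forall x, c 0%N x <-> I x, forall i, (i <= n)%N -> is_ideal (c i),
      forall i, (i < n)%N -> strict_sub (c i) (c i.+1) & psubset (c n) J].

Lemma reach0 I J : is_ideal I -> psubset I J -> reach I 0 J.
Proof. by move=> idI IJ; exists (fun=> I). Qed.

Lemma reach_mono I n J J' : psubset J J' -> reach I n J -> reach I n J'.
Proof. by move=> JJ [c [c0 ci cs cn]]; exists c; split=> // x /cn/JJ. Qed.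

Lemma reach_step I n J J' :
  reach I n J -> is_ideal J' -> strict_sub J J' -> reach I n.+1 J'.
Proof.
move=> [c [c0 ci cs cn]] idJ [JJ [x [Jx nJx]]].
exists (fun i => if (i <= n)%N then c i else J'); split=> //.
- by move=> i _; case: ifP => // /ci.
- move=> i; rewrite ltnS => iin; rewrite iin.
  case: (ltnP i n) => [/cs //|ni].
  have -> : i = n by apply/eqP; rewrite eqn_leq iin.
  by split; [move=> y /cn/JJ|exists x; split=> // /cn].
- by rewrite ltnn.
Qed.

Lemma reach_top I n : reach I n (fun=> True) ->
  exists2 n', (n <= n')%N & ideal_chain_to_top I n'.
Proof.
move=> [c [c0 ci cs cn]]; case: (pselect (forall x, c n x)) => [all|/existsNP[x nx]].
  by exists n => //; exists c.
exists n.+1 => //; exists (fun i => if (i <= n)%N then c i else fun=> True).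
split=> //; split; first by rewrite ltnn.
split; first by move=> i _; case: ifP => // /ci.
move=> i; rewrite ltnS => iin; rewrite iin; case: (ltnP i n) => [/cs //|ni].
have -> : i = n by apply/eqP; rewrite eqn_leq iin.
by split=> //; exists x.
Qed.

Lemma chain_mono (c : nat -> A -> Prop) n i j :
  (forall i, (i < n)%N -> strict_sub (c i) (c i.+1)) -> (i <= j <= n)%N -> psubset (c i) (c j).
Proof.
move=> cs; elim: j => [|j IH] /andP[ij jn]; first by case: i ij => [_ x|].
case: (ltnP j i) => ji; first by have -> : i = j.+1 by apply/eqP; rewrite eqn_leq ij.
by have [sub _] := cs j jn; move=> x /IH h; apply/sub/h; rewrite ji ltnW.
Qed.

(** [colength] is an epsilon choice and means something only once a longest chain exists; one chain
    and a uniform bound provide it. *)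
Lemma colength_spec I n B : ideal_chain_to_top I n ->
  (forall k, ideal_chain_to_top I k -> (k <= B)%N) -> colength_is I (colength I).
Proof.
move=> In bnd; apply: epsilon_spec.
by have [k Ik km] := exists_max (ex_intro _ n In) bnd; exists k.
Qed.

End Chains.

Section Colength.

Import mathcomp.algebra_tactics.ring.

Variables (A : idomainType) (m : A -> Prop) (d : nat) (a : 'I_d -> R).
Variable nu : {fraction A} -> 'I_d -> Z.
Hypotheses (loc : is_local m) (ok : OK_relative m a nu) (qa : Qlin_indep a).

Local Notation F := {fraction A}.
Local Notation "x %:F" := (@tofrac A x).
Local Notation vec := (vec nu).
Local Notation hgt := (hgt a nu).
Local Notation vge := (vge a nu).
Local Notation vgt := (vgt a nu).
Local Notation inspan := (inspan a nu).
Local Notation vfree := (vfree a nu).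
Local Notation vect := {ffun 'I_d -> Z}.
Implicit Types (ys : seq F) (r c : A) (s t : R) (I J : A -> Prop).

Definition vals I : vect -> Prop := fun u => exists r, [/\ I r, r != 0 & vec (r%:F) = u].
Definition top : A -> Prop := fun=> True.

Lemma vals_strip : exists2 delta, (0 < delta)%RR & forall I, in_strip a delta (vals I).
Proof.
case: ok => _ [_ [_ [cone _]]]; have [delta delta0 hd] := cone_height_bound cone.
exists delta => // I u [r [_ r0 <-]] i.
have := hd (nu (r%:F)) (ex_intro _ r (conj r0 (fun=> erefl))) i.
by rewrite ipZ_nu /vec ffunE.
Qed.

Lemma vals_add I u v : is_ideal I -> vals I u -> vals top v -> vals I (v + u).
Proof.
move=> [_ [_ IM]] [r [Ir r0 <-]] [r' [_ r'0 <-]]; exists (r' * r); split.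
- exact: IM.
- by rewrite mulf_neq0.
- by rewrite tofracM (vecM ok) ?tofrac_eq0.
Qed.

Lemma vals_top0 : vals top 0.
Proof. by exists 1; rewrite tofrac1 (vec1 ok) oner_neq0. Qed.

Lemma vals_top_add u v : vals top u -> vals top v -> vals top (u + v).
Proof. by move=> hu hv; apply: vals_add. Qed.

Lemma vals_top_muln u k : vals top u -> vals top (u *+ k).
Proof.
move=> hu; elim: k => [|k IH]; first by rewrite mulr0n; exact: vals_top0.
by rewrite mulrS; apply: vals_top_add.
Qed.

(* As nu is onto Z^d, some s and all s + e_i are values; take w = d * s. *)
Lemma deep_value : exists2 w : vect, (0 <= ht a w)%RR &
  forall k (r : vect), (forall i, (0 <= r i < Z.of_nat k)%ZZ) -> vals top (w *+ k + r).
Proof.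
pose e i : vect := [ffun j => if j == i then 1%ZZ else 0%ZZ].
have /choice[x xP] : forall i, exists x, x != 0 /\ vec x = e i.
  by move=> i; have [x x0 xe] := vec_surj ok (e i); exists x.
have [b b0 [cs hb]] := frac_common_denom [seq x i | i <- enum 'I_d].
pose s := vec (b%:F).
have Ss : vals top s by exists b.
have Se i : vals top (s + e i).
  have : b%:F * x i \in map (@tofrac A) cs.
    by rewrite -hb; apply/map_f/map_f; rewrite mem_enum.
  case/mapP => c _ ec; have [x0 xe] := xP i.
  have bF : b%:F != 0 by rewrite tofrac_eq0.
  exists c; split=> //; last by rewrite -ec (vecM ok) // xe.
  by rewrite -tofrac_eq0 -ec mulf_neq0.
have [delta delta0 str] := vals_strip.
exists (s *+ d).
  by apply: (in_strip_ge0 delta0 (str top)); apply: vals_top_muln.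
move=> k r rk.
(* For each i, k - r_i copies of s and r_i copies of s + e_i make k s + r_i e_i; the sum over i is d
   k s + r. *)
have -> : s *+ d *+ k + r =
    \sum_(i < d) (s *+ (k - Z.to_nat (r i)) + (s + e i) *+ Z.to_nat (r i)).
  under eq_bigr => i _.
    rewrite mulrnDl addrA -mulrnDr subnK; last by apply/leP; have := rk i; lia.
    over.
  rewrite big_split /= sumr_const card_ord -!mulrnA mulnC; congr (_ + _).
  apply/ffunP => j; rewrite sum_ffunE (bigD1 j) //= ffunMnE ffunE eqxx big1 ?addr0.
    have := rk j; move: (r j) => z zk.
    have natZ n : (1%ZZ *+ n)%R = Z.of_nat n.
      by elim: n => [|n IH] //; rewrite mulrS IH Nat2Z.inj_succ -Z.add_1_l.
    by rewrite natZ; lia.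
  by move=> i /negbTE ij; rewrite ffunMnE ffunE eq_sym ij mul0rn.
apply: (big_ind (vals top)) => [||i _]; [exact: vals_top0|exact: vals_top_add|].
by apply: vals_top_add; apply: vals_top_muln.
Qed.

(** A maximal free family at height 0 is multiplied by a common denominator [beta], which moves it
    into R and to the height of [beta]. *)
Lemma residue_dim_integral : exists (f : nat) (beta : A) (cs : seq A),
  [/\ (0 < f)%N, beta != 0, size cs = f, vfree (hgt (beta%:F)) (map (@tofrac A) cs) &
   forall z ys, z != 0 -> vfree (hgt z) ys -> (size ys <= f)%N].
Proof.
have [f [f0 [[ys fy sf] fmax]]] := residue_dim loc ok.
have [b b0 [cs e]] := frac_common_denom ys.
have bF : b%:F != 0 by rewrite tofrac_eq0.
exists f, b, cs; split=> //; first by rewrite -sf -(size_map (@tofrac A)) -e size_map.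
by rewrite -e -[hgt _]Rplus_0_l; apply: (free_scale ok).
Qed.

Section Bounds.

Variable I : A -> Prop.
Hypothesis idI : is_ideal I.

(** The ideal of elements of R in I + span(ys) + F_(> t). Adding the vectors of a free family one by
    one gives consecutive members of a chain. *)
Definition level t ys : A -> Prop := fun r => exists2 z : A, I z & inspan t ys (r%:F - z%:F).

Lemma level_ideal t ys : is_ideal (level t ys).
Proof.
case: idI => I0 [ID IM]; split.
  by exists 0 => //; rewrite subrr; apply: inspan_gt => //; left.
split=> [r r' [z Iz hz] [z' Iz' hz']|r r' [z Iz hz]].
  exists (z + z'); first exact: ID.
  have := inspan_add ok hz hz'; congr (inspan _ _ _); rewrite !tofracD; ring.
exists (r * z); first exact: IM.
by rewrite !tofracM -mulrBr; apply: (inspan_smul ok).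
Qed.

Lemma reach_level t n (cs : seq A) : vfree t (map (@tofrac A) cs) ->
  (forall r, I r -> r != 0 -> hgt (r%:F) <> t) ->
  reach I n (level t [::]) -> reach I (n + size cs) (level t (map (@tofrac A) cs)).
Proof.
move=> fc It rn; elim: cs fc => [|c cs IH] fc; first by rewrite addn0.
rewrite addnS; case: fc => gc [nc fcs]; apply: reach_step (IH fcs) _ _.
  exact: level_ideal.
split; first by move=> r [z Iz hz]; exists z => //; apply: inspan_cons.
exists c; split.
  exists 0; first by case: idI.
  by exists 1; rewrite tofrac0 tofrac1 mul1r subr0 subrr; apply: inspan_gt => //; left.
move=> [z Iz hz]; apply: nc.
have gz : vge t (z%:F).
  have -> : z%:F = c%:F - (c%:F - z%:F) by ring.
  apply: (vge_add ok) => //; apply: (vge_opp ok); apply: (inspan_ge ok _ hz).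
  exact: (free_ge fcs).
have gtz : vgt t (z%:F).
  case: gz => [->|tz]; first by left.
  case: (eqVneq z 0) => [->|z0]; first by left; rewrite tofrac0.
  by right; have := It z Iz z0; case: (Rle_lt_or_eq_dec _ _ tz) => // ->.
have -> : c%:F = (c%:F - z%:F) + z%:F by ring.
by apply: (inspan_add ok) => //; apply: inspan_gt.
Qed.

(** The chain grows from I through decreasing heights: the head of [l] has the least height and is
    treated last, since [level] at a lower height contains everything built before. *)
Lemma reach_sorted f (l : seq vect) t :
  (forall u, u \in l -> exists cs, [/\ size cs = f, vfree (ht a u) (map (@tofrac A) cs) &
     forall r, I r -> r != 0 -> hgt (r%:F) <> ht a u]) ->
  sorted (fun u v => `[< (ht a u < ht a v)%RR >]) l -> (forall u, u \in l -> (t < ht a u)%RR) ->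
  reach I (f * size l) (level t [::]).
Proof.
have tr : transitive (fun u v : vect => `[< (ht a u < ht a v)%RR >]).
  by move=> v u w /asboolP uv /asboolP vw; apply/asboolP; lra.
elim: l t => [|u l IH] t lP /=.
  move=> _ _; rewrite muln0; apply: reach0 => // r Ir; exists r => //.
  by rewrite subrr; left.
move=> pul tl; have [cs [scs fcs Iu]] := lP u (mem_head _ _).
rewrite mulnS addnC -scs; apply: reach_mono (reach_level fcs Iu _).
  move=> r [z Iz hz]; exists z => //=; apply: (vge_lt (tl u (mem_head _ _))).
  exact: (inspan_ge ok (free_ge fcs) hz).
rewrite scs; apply: IH; last 2 first.
- exact: path_sorted pul.
- by move=> v vl; have /allP/(_ v vl)/asboolP := order_path_min tr pul.
- by move=> v vl; apply: lP; rewrite inE vl orbT.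
Qed.

Lemma reach_values f (l : seq vect) : uniq l ->
  (forall u, u \in l -> (0 <= ht a u)%RR /\
     exists cs, [/\ size cs = f, vfree (ht a u) (map (@tofrac A) cs) &
     forall r, I r -> r != 0 -> hgt (r%:F) <> ht a u]) ->
  exists2 n, (f * size l <= n)%N & ideal_chain_to_top I n.
Proof.
move=> ul lP; apply: reach_top.
pose leT (u v : vect) := `[< (ht a u <= ht a v)%RR >].
(* The starting height must be strictly below all heights in [l], which are at least 0; hence -1.
   Strict sortedness uses that distinct values have distinct heights. *)
rewrite -(size_sort leT); apply: reach_mono (reach_sorted (t := (-1)%RR) _ _ _) => //.
- by move=> u; rewrite mem_sort => /lP[].
- have tr : transitive leT by move=> v u w /asboolP uv /asboolP vw; apply/asboolP; lra.
  have tot : total leT.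
    by move=> u v; rewrite /leT; case: (Rle_lt_dec (ht a u) (ht a v)) => h;
      apply/orP; [left|right]; apply/asboolP; lra.
  have := sort_sorted tot l; have : uniq (sort leT l) by rewrite sort_uniq.
  elim: (sort leT l) => [|u [|v s] IH] //= /andP[]; rewrite inE negb_or.
  move=> /andP[uv _] us /andP[/asboolP le ss]; apply/andP; split; last exact: IH.
  by apply/asboolP; case: (Rle_lt_or_eq_dec _ _ le) => // /(ht_inj qa) e; rewrite e eqxx in uv.
- by move=> u; rewrite mem_sort => /lP[h0 _]; lra.
Qed.

Section Upper.

Variables (delta t0 : R).
Hypotheses (delta0 : (0 < delta)%RR) (str : forall J, in_strip a delta (vals J)).
Hypothesis It0 : forall r, vge t0 (r%:F) -> I r.

(* A step of a chain is detected by an element of maximal value in the difference: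
   subtracting elements of the smaller ideal raises the value only finitely often. *)
Lemma step_witness J J' : is_ideal J -> is_ideal J' -> psubset I J -> strict_sub J J' ->
  exists2 x : A, J' x & forall y, J y -> ~ vgt (hgt (x%:F)) (x%:F - y%:F).
Proof.
move=> idJ idJ' IJ [JJ [x0 [J'x0 nJx0]]]; apply: contrapT => no.
(* [M x] counts values of R above x and below [t0]. Elements of height at least [t0] lie in I, hence
   in J, so each improvement lowers [M] strictly. *)
pose M (x : A) := count (fun u => `[< (hgt (x%:F) < ht a u)%RR >]) (below a delta (vals top) t0).
have improve x : J' x -> ~ J x -> exists x', [/\ J' x', ~ J x' & (M x' < M x)%N].
  move=> J'x nJx.
  have [y Jy gy] : exists2 y, J y & vgt (hgt (x%:F)) (x%:F - y%:F).
    by apply: contrapT => no'; apply: no; exists x => // y Jy gy; apply: no'; exists y.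
  have nJ : ~ J (x - y).
    by move=> Jxy; apply: nJx; rewrite -(subrK y x); case: idJ => _ [JD _]; apply: JD.
  have xy0 : x - y != 0 by apply/eqP => e; apply: nJ; rewrite e; case: idJ.
  have {}gy : (hgt (x%:F) < hgt ((x - y)%:F))%RR.
    by case: gy => [/eqP|]; rewrite -tofracB // tofrac_eq0 (negbTE xy0).
  exists (x - y); split=> //.
    case: idJ' => _ [J'D J'M]; apply: J'D => //; rewrite -mulN1r; apply: J'M; exact: JJ.
  rewrite /M -!size_filter; set u0 := vec ((x - y)%:F).
  have u0in : u0 \in below a delta (vals top) t0.
    apply/(mem_below delta0 _ _ (@str top)); split; first by exists (x - y).
    by apply: Rnot_le_lt => le; apply: nJ; apply/IJ/It0; right.
  pose s x := [seq u <- below a delta (vals top) t0 | `[< (hgt (x%:F) < ht a u)%RR >]].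
  apply: (@uniq_leq_size _ (u0 :: s (x - y)) (s x)) => /=.
    rewrite filter_uniq ?below_uniq // andbT mem_filter; apply/nandP; left.
    by apply/asboolP; rewrite /hgt -/u0; lra.
  move=> u; rewrite inE => /orP[/eqP->|].
    by rewrite mem_filter u0in andbT; apply/asboolP.
  rewrite mem_filter => /andP[/asboolP lt ub]; rewrite mem_filter ub andbT.
  by apply/asboolP; lra.
have wf k x : (M x <= k)%N -> J' x -> ~ J x -> False.
  elim: k x => [|k IH] x Mk J'x nJx; have [x' [J'x' nJx' MM]] := improve x J'x nJx.
    by move: (leq_trans MM Mk).
  by apply: (IH x') => //; rewrite -ltnS; apply: leq_trans MM Mk.
exact: (wf _ x0 (leqnn _)).
Qed.

(** The witness of step i has a leading form found in no element of [c i]. Its value lies in L,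
    because elsewhere I supplies all leading forms; witnesses of equal value are free over k, so at
    most f steps share a value. *)
Lemma chain_upper f n (L : seq vect) :
  (forall z ys, z != 0 -> vfree (hgt z) ys -> (size ys <= f)%N) ->
  (forall r, r != 0 -> vec (r%:F) \notin L ->
     forall x : A, vge (hgt (r%:F)) (x%:F) ->
     exists2 z, I z & vgt (hgt (r%:F)) (x%:F - z%:F)) ->
  ideal_chain_to_top I n -> (n <= f * size L)%N.
Proof.
move=> fmax full [c [c0 [_ [ci cs]]]].
have cmono i j : (i <= j <= n)%N -> psubset (c i) (c j) by apply: chain_mono.
have Ic i : (i <= n)%N -> psubset I (c i).
  by move=> iin x /c0; apply: cmono.
have /choice[x xP] : forall i, exists x : A, (i < n)%N ->
    c i.+1 x /\ forall y, c i y -> ~ vgt (hgt (x%:F)) (x%:F - y%:F).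
  move=> i; case: (ltnP i n) => iin; last by exists 0.
  have [x cx nx] := step_witness (ci _ (ltnW iin)) (ci _ iin) (Ic _ (ltnW iin)) (cs _ iin).
  by exists x.
pose key i := vec ((x i)%:F).
have x0 i : (i < n)%N -> x i != 0.
  move=> iin; apply/eqP => e; have [_ /(_ 0)[]] := xP i iin.
    by case: (ci _ (ltnW iin)).
  by rewrite e tofrac0 subr0; left.
have keyL : {in iota 0 n, forall i, key i \in L}.
  move=> i; rewrite mem_iota /= add0n => iin; apply: contraT => nL.
  have [z Iz hz] := full _ (x0 i iin) nL (x i) (or_intror (Rle_refl _)).
  by case: (xP i iin) => _ /(_ z (Ic _ (ltnW iin) _ Iz)).
rewrite -[n](size_iota 0); apply: leq_trans (size_le_sum_count keyL) _.
rewrite mulnC.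
have -> : (size L * f = \sum_(u <- L) f)%N by rewrite big_const_seq count_predT iter_addn_0 mulnC.
apply: leq_sum => u _; rewrite -size_filter.
(* The indices are reversed because [vfree] tests a vector against the later ones in the list, while
   x j is independent of [c j], which contains x i for i < j. *)
set js := filter _ _; have : all (fun i => (i < n)%N && (key i == u)) (rev js).
  by rewrite all_rev; apply/allP => i; rewrite mem_filter mem_iota /= add0n andbC.
have : sorted (fun i j => j < i)%N (rev js).
  by rewrite rev_sorted; exact: (sorted_filter ltn_trans _ (iota_ltn_sorted 0 n)).
rewrite -(size_rev js); move: (rev js) => l {js} sl al.
have trg : transitive (fun i j => j < i)%N by move=> i j k ji ik; apply: ltn_trans ik ji.
have fl : vfree (ht a u) [seq (x i)%:F | i <- l].
  elim: l sl al => [|j l IH] //= pl /andP[/andP[jn /eqP ju] al]; split.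
    by right; rewrite /hgt -/(key j) ju; lra.
  split; last exact: IH (path_sorted pl) al.
  have hj : hgt ((x j)%:F) = ht a u by rewrite -ju.
  move=> sp; have [|r cr] := inspan_closed (ci _ (ltnW jn)) _ sp.
    move=> _ /mapP[i il ->]; exists (x i) => //.
    have ij : (i < j)%N.
      by have /allP/(_ i il) := order_path_min trg pl.
    apply: (cmono i.+1); first by rewrite ij ltnW.
    by case: (xP i (ltn_trans ij jn)).
  by rewrite -hj; case: (xP j jn) => _ /(_ r cr).
case: l sl al fl => [|j l] // _ /= /andP[/andP[jn /eqP ju] _] fl.
have := fmax ((x j)%:F) [seq (x i)%:F | i <- j :: l]; rewrite size_map; apply.
  by rewrite tofrac_eq0 x0.
by rewrite /hgt -/(key j) ju.
Qed.

End Upper.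

End Bounds.

(* f is [k_V : k] and w is the value of a common denominator of a basis of k_V over k: the
   graded piece of I at a value u + w with u a value of I is all of F_(>= u+w) / F_(> u+w). *)
Lemma colength_bounds delta : (0 < delta)%RR -> (forall J, in_strip a delta (vals J)) ->
  exists f w, [/\ (0 < f)%N, (0 <= ht a w)%RR &
    forall I t0, is_ideal I -> (forall r, vge t0 (r%:F) -> I r) ->
    (f * cnt a delta (vals top) (t0 - ht a w) <= colength I + f * cnt a delta (vals I) t0)%N /\
    (colength I + f * cnt a delta (vals I) t0 <= f * cnt a delta (vals top) (t0 + ht a w))%N].
Proof.
move=> delta0 str.
have [f [b [cs [f0 b0 scs fcs fmax]]]] := residue_dim_integral.
have bF : b%:F != 0 by rewrite tofrac_eq0.
pose w := vec (b%:F); have Sw : vals top w by exists b.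
have w0 : (0 <= ht a w)%RR by apply: (in_strip_ge0 delta0 (str top)).
exists f, w; split=> // I t0 idI It0.
have shift_free z : z != 0 ->
    vfree (ht a (vec (z%:F) + w)) (map (@tofrac A) (map ( *%R z) cs)).
  move=> z0; rewrite htD Rplus_comm.
  have := free_scale ok (z := z%:F) _ fcs; rewrite tofrac_eq0 => /(_ z0).
  congr (vfree _ _); rewrite -!map_comp; apply: eq_map => y /=; exact/esym/tofracM.
(* At a value v + w the products of z, of value v, with [cs] give f independent leading forms from
   R; every such value below t0 that I misses yields f steps. *)
pose T1 (u : vect) := exists2 v, vals top v & u = v + w.
have T1S u : T1 u -> vals top u by move=> [v Sv ->]; apply: vals_top_add.
have strT1 : in_strip a delta T1 by move=> u /T1S; apply: str.
pose l := [seq u <- below a delta T1 t0 | ~~ `[< vals I u >]].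
have lP u : u \in l -> [/\ T1 u, (ht a u < t0)%RR & ~ vals I u].
  rewrite mem_filter => /andP[/asboolP nI /(mem_below delta0 _ _ strT1)[]].
  by split.
have [||n ln In] := @reach_values I idI f l.
- by rewrite filter_uniq // below_uniq.
- move=> u /lP[[v [z [_ z0 <-]] ->] _ nI]; split.
    by apply: (in_strip_ge0 delta0 (str top)); apply: T1S; exists (vec (z%:F)) => //; exists z.
  exists (map ( *%R z) cs); split; [by rewrite size_map|exact: shift_free|].
  move=> r Ir r0 /(ht_inj qa) e; apply: nI; by exists r.
(* I is full at the values in [T2], and from height t0 + ht w on by truncation. This cut makes the
   removed values exactly the translates by w of the values of I below t0. *)
pose T2 (u : vect) := exists2 v, vals I v & u = w + v.
pose D (u : vect) := ~~ `[< T2 u /\ (ht a u < t0 + ht a w)%RR >].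
pose L := [seq u <- below a delta (vals top) (t0 + ht a w) | D u].
have up k : ideal_chain_to_top I k -> (k <= f * size L)%N.
  apply: (chain_upper delta0 str It0 fmax) => r r0 rL x gx.
  case: (Rlt_le_dec (hgt (r%:F)) (t0 + ht a w)) => hr; last first.
    exists x; last by rewrite subrr; left.
    by apply: It0; apply: (vge_le _ gx); lra.
  have : ~~ D (vec (r%:F)).
    move: rL; rewrite mem_filter negb_and => /orP[//|/negP[]].
    by apply/(mem_below delta0 _ _ (str top)); split=> //; exists r.
  rewrite negbK => /asboolP[[v [z [Iz z0 <-]] er] _].
  have hrz : hgt (r%:F) = ht a (vec (z%:F) + w) by rewrite /hgt er addrC.
  have fz := shift_free z z0; rewrite -hrz in fz.
  apply: (inspan_closed idI (ys := map (@tofrac A) (map ( *%R z) cs))).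
    move=> y /mapP[_ /mapP[c _ ->] ->]; exists (z * c) => //.
    by rewrite mulrC; case: idI => _ [_]; apply.
  (* Otherwise x would extend the f vectors to a free family of f + 1 at the height of r. *)
  apply: contrapT => nsp.
  have := fmax (r%:F) (x%:F :: map (@tofrac A) (map ( *%R z) cs)).
  rewrite tofrac_eq0 r0 /= !size_map scs ltnn => /(_ isT) abs.
  by suff : false by []; apply: abs; split.
have [Ic cmax] := colength_spec In up.
split.
  have h1 := cnt_shift delta0 (t0 - ht a w)%RR (w := w) (str top) strT1
    (fun u Su => ex_intro2 _ _ u Su erefl).
  have {h1} : (cnt a delta (vals top) (t0 - ht a w) <= cnt a delta T1 t0)%N.
    by move: h1; rewrite (_ : t0 - ht a w + ht a w = t0)%RR //; lra.
  have h2 : (cnt a delta T1 t0 <= size l + cnt a delta (vals I) t0)%N.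
    rewrite /cnt -size_cat; apply: uniq_leq_size; first exact: below_uniq.
    move=> u uT; rewrite mem_cat mem_filter uT andbT.
    case: (pselect (vals I u)) => Iu; last by rewrite (asboolF Iu).
    apply/orP; right; apply/(mem_below delta0 _ _ (str I)); split=> //.
    by case/(mem_below delta0 _ _ strT1): uT.
  move=> h1; have := cmax _ In; have := leq_trans h1 h2.
  rewrite -(leq_pmul2l f0) mulnDr => h3 h4.
  by apply: leq_trans h3 _; rewrite leq_add2r; apply: leq_trans ln h4.
apply: leq_trans (leq_add (up _ Ic) (leqnn _)) _; rewrite -mulnDr leq_pmul2l //.
have -> : cnt a delta (vals top) (t0 + ht a w)%RR = (size L +
    size [seq u <- below a delta (vals top) (t0 + ht a w)%RR | predC D u])%N.
  by rewrite !size_filter count_predC.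
rewrite leq_add2l /cnt -(size_map (fun u => w + u)); apply: uniq_leq_size.
  by rewrite map_inj_uniq ?below_uniq //; apply: addrI.
move=> _ /mapP[u /(mem_below delta0 _ _ (str I))[Iu ut] ->].
have hut : (ht a (w + u)%R < t0 + ht a w)%RR by rewrite htD; lra.
rewrite mem_filter /= negbK; apply/andP; split.
  by apply/asboolP; split=> //; exists u.
apply/(mem_below delta0 _ _ (str top)); split=> //.
by case: Iu => r [_ r0 er]; apply: vals_top_add => //; exists r.
Qed.

End Colength.

(** * Truncation: elements of large height lie in the ideals *)

Section Ideals.

Variable A : idomainType.
Implicit Types (J S m : A -> Prop).

Lemma ideal_gen_ideal S : is_ideal (ideal_gen S).
Proof.
split; first by exists [::]; split; [constructor|rewrite big_nil].
split=> [x y [rs [hr ->]] [rs' [hr' ->]]|r x [rs [hr ->]]].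
  exists (rs ++ rs'); split; first by apply/List.Forall_app.
  by rewrite big_cat.
exists [seq (r * t.1, t.2) | t <- rs]; split.
  by elim: rs hr => [|t rs IH] hr /=; [constructor|inversion_clear hr; constructor; auto].
by rewrite big_map mulr_sumr; apply: eq_bigr => t _; rewrite mulrA.
Qed.

Lemma ideal_gen_mem S x : S x -> ideal_gen S x.
Proof.
move=> Sx; exists [:: (1, x)]; split; first by constructor.
by rewrite big_seq1 mul1r.
Qed.

Lemma ideal_gen_sub S J : is_ideal J -> psubset S J -> psubset (ideal_gen S) J.
Proof.
move=> [J0 [JD JM]] SJ x [rs [hr ->]]; elim: rs hr => [|t rs IH] hr.
  by rewrite big_nil.
inversion_clear hr; rewrite big_cons; apply: JD; last exact: IH.
by apply: JM; apply: SJ.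
Qed.

Lemma noetherian_finite_gen J : noetherian A -> is_ideal J ->
  exists2 xs : seq A, (forall x, x \in xs -> J x) & psubset J (ideal_gen (fun z => z \in xs)).
Proof.
move=> noeth idJ; apply: contrapT => no.
have pick (xs : seq A) : exists x, (forall y, y \in xs -> J y) ->
    J x /\ ~ ideal_gen (fun z => z \in xs) x.
  case: (pselect (forall y, y \in xs -> J y)) => h; last by exists 0.
  apply: contrapT => no'; apply: no; exists xs => // x Jx; apply: contrapT => nx.
  by apply: no'; exists x.
have [f fP] := choice pick.
pose s := fix s n : seq A := if n is n'.+1 then f (s n') :: s n' else [::].
have sJ n : forall y, y \in s n -> J y.
  by elim: n => [|n IH] y //=; rewrite inE => /orP[/eqP->|/IH //]; case: (fP _ IH).
have [||n stab] := noeth (fun n => ideal_gen (fun z => z \in s n)).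
- by move=> n; apply: ideal_gen_ideal.
- move=> n; apply: ideal_gen_sub; first exact: ideal_gen_ideal.
  by move=> x xs; apply: ideal_gen_mem; rewrite inE xs orbT.
have [_] := fP _ (sJ n); apply; apply: (stab n.+1) => //.
by apply: ideal_gen_mem; rewrite inE eqxx.
Qed.

Lemma prod_count (x : A) ys : exists z, \prod_(y <- ys) y = z * x ^+ count_mem x ys.
Proof.
elim: ys => [|y ys [z e]]; first by exists 1; rewrite big_nil mulr1.
rewrite big_cons e /=; case: eqP => [->|_]; last by exists (y * z); rewrite mulrA.
by exists z; rewrite exprD expr1 mulrCA.
Qed.

Lemma prod_in_ideal J (xs : seq A) c ys : is_ideal J -> (forall x, x \in xs -> J (x ^+ c)) ->
  (forall y, y \in ys -> y \in xs) -> (size xs * c < size ys)%N -> J (\prod_(y <- ys) y).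
Proof.
move=> [J0 [JD JM]] Jx ysx lt.
have [x xxs cx] : exists2 x, x \in xs & (c < count_mem x ys)%N.
  apply: contrapT => no; suff : (size ys <= size xs * c)%N by rewrite leqNgt lt.
  have keyL : {in ys, forall y, id y \in xs} by [].
  apply: leq_trans (size_le_sum_count keyL) _.
  have -> : (size xs * c = \sum_(u <- xs) c)%N.
    by rewrite big_const_seq count_predT iter_addn_0 mulnC.
  rewrite big_seq [leqRHS]big_seq; apply: leq_sum => x xxs.
  by rewrite leqNgt; apply/negP => lt'; apply: no; exists x.
have [z ->] := prod_count x ys; rewrite -(subnK (ltnW cx)) exprD mulrA.
by apply: JM; apply: Jx.
Qed.

(** Each factor from m is expanded in the generators [xs], and [ys] in [gen] collects the generators
    extracted so far. A monomial of degree above size xs * c contains some x with exponent at least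
    c. *)
Lemma ideal_pow_sub m J (xs : seq A) c n : is_ideal J -> psubset m (ideal_gen (fun z => z \in xs)) ->
  (forall x, x \in xs -> J (x ^+ c)) -> (size xs * c < n)%N -> psubset (ideal_pow m n) J.
Proof.
move=> idJ mxs Jx lt; apply: ideal_gen_sub => // _ [f [fm ->]].
have [J0 [JD JM]] := idJ.
suff gen k (g : 'I_k -> A) ys : (forall i, m (g i)) -> (forall y, y \in ys -> y \in xs) ->
    (size xs * c < k + size ys)%N -> J ((\prod_(i < k) g i) * \prod_(y <- ys) y).
  by have := gen n f [::] fm; rewrite addn0 big_nil mulr1; apply.
elim: k g ys => [|k IH] g ys gm ysx szk.
  by rewrite big_ord0 mul1r; apply: (prod_in_ideal idJ Jx).
rewrite big_ord_recl; have [rs [hr ->]] := mxs _ (gm ord0).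
elim: rs hr => [|t rs IHr] hr; first by rewrite big_nil !mul0r.
inversion_clear hr; rewrite big_cons !mulrDl; apply: JD; last exact: IHr.
rewrite -!mulrA; apply: JM.
have := IH (fun i => g (lift ord0 i)) (t.2 :: ys); rewrite big_cons mulrCA; apply=> //.
  by move=> y; rewrite inE => /orP[/eqP->|/ysx].
by rewrite /= addnS -addSn.
Qed.

Lemma frob_pow_mem J q x : J x -> frob_pow J q (x ^+ q).
Proof. by move=> Jx; apply: ideal_gen_mem; exists x. Qed.

Lemma p_family_expn p (I : nat -> A -> Prop) e k x :
  p_family p I -> I e x -> I (e + k)%N (x ^+ (p ^ k)).
Proof.
move=> pI Ix; elim: k => [|k IH]; first by rewrite addn0 expr1.
by rewrite addnS expnSr exprM; apply/pI/frob_pow_mem.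
Qed.

Lemma common_exponent m J (xs : seq A) : m_primary m J -> (forall x, x \in xs -> m x) ->
  exists c, forall x, x \in xs -> J (x ^+ c).
Proof.
move=> [[J0 [JD JM]] [_ nil]]; elim: xs => [|x xs IH] xm; first by exists 0%N.
have [y yxs|c hc] := IH; first by apply: xm; rewrite inE yxs orbT.
have [n hn] := nil x (xm x (mem_head _ _)).
exists (c + n)%N => y; rewrite inE exprD => /orP[/eqP->|/hc h]; first exact: JM.
by rewrite mulrC; apply: JM.
Qed.

End Ideals.

Section Truncation.

Variables (A : idomainType) (m : A -> Prop) (d : nat) (a : 'I_d -> R).
Variable nu : {fraction A} -> 'I_d -> Z.
Hypotheses (noeth : noetherian A) (loc : is_local m) (ok : OK_relative m a nu).

Local Notation "x %:F" := (@tofrac A x).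
Local Notation vec := (vec nu).
Local Notation hgt := (hgt a nu).
Local Notation vge := (vge a nu).

(** Writing the exponent as c * q makes the threshold linear in q for fixed c. For I_q the c comes
    from I_1; for m^[q] it is 1. *)
Lemma truncation : exists (xs : seq A) B, [/\ (0 < B)%RR, forall x, x \in xs -> m x &
  forall (J : A -> Prop) c q, is_ideal J -> (0 < q)%N -> (forall x, x \in xs -> J (x ^+ (c * q))) ->
    forall r, vge (INR (size xs * c + 1) * B * INR q)%RR (r%:F) -> J r].
Proof.
have [xs xm mxs] := noetherian_finite_gen noeth (proj1 loc).
case: (ok) => _ [_ [_ [_ [_ [v hv]]]]].
(* The height of the vector v of (iv) has no prescribed sign; the maximum with 1 makes B
   positive. *)
exists xs, (Rmax (ipZ v a) 1)%RR; split=> //; first by have := Rmax_r (ipZ v a) 1; lra.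
move=> J c q idJ q0 Jx r hr.
pose n := ((size xs * c + 1) * q)%N.
apply: (ideal_pow_sub (n := n) idJ mxs Jx).
  by rewrite /n mulnDl mul1n mulnA -[X in (X < _)%N]addn0 ltn_add2l.
apply: hv; case: hr => [->|hr]; [by left|right].
rewrite ipZ_nu; apply: Rle_trans hr.
have -> : ipZ (fun i => Z.mul (Z.of_nat n) (v i)) a = (INR n * ipZ v a)%RR.
  rewrite /ipZ -Rsum_scale; apply: eq_bigr => i _.
  by rewrite mult_IZR -INR_IZR_INZ Rmult_assoc.
have mono (M x y z : R) : (0 <= x)%RR -> (0 <= y)%RR -> (z <= M)%RR ->
    (x * y * z <= x * M * y)%RR.
  by move=> x0 y0 zM; have xy0 := Rmult_le_pos _ _ x0 y0; nra.
by rewrite /n mult_INR; apply: mono; [exact: pos_INR|exact: pos_INR|exact: Rmax_l].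
Qed.

(** A non-zero x in m has positive height, so some coordinate of its value is a non-zero integer,
    and the strip condition gives height at least delta. The q-th power multiplies this by q. *)
Lemma frob_pow_height delta q : (0 < delta)%RR -> (forall J, in_strip a delta (vals nu J)) ->
  psubset (frob_pow m q) (fun r => vge (delta * INR q)%RR (r%:F)).
Proof.
move=> delta0 str r [rs [hr ->]].
elim: rs hr => [|t rs IH] hr; first by rewrite big_nil tofrac0; left.
inversion_clear hr as [|? ? [x [mx tx]] hrs]; rewrite big_cons tofracD tofracM tx.
apply: (vge_add ok); last exact: IH.
apply: (vge_smul ok); case: (eqVneq x 0) => [->|xn0].
  case: q {IH tx hrs} => [|q]; last by rewrite expr0n tofrac0; left.
  by right; rewrite expr0 tofrac1 (hgt1 ok) Rmult_0_r; lra.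
have xF : x%:F != 0 by rewrite tofrac_eq0.
right; rewrite tofracXn /hgt (vecX ok) // htMn Rmult_comm.
apply: Rmult_le_compat_l; first exact: pos_INR.
have hx : (0 < hgt (x%:F))%RR.
  by have /(max_ideal_vgt ok) [/eqP|] := mx; rewrite ?(negbTE xF).
have [i vi] : exists i, vec (x%:F) i <> 0%ZZ.
  apply: contrapT => no; move: hx; rewrite /hgt.
  have -> : vec (x%:F) = 0; last by rewrite ht0; lra.
  by apply/ffunP => i; rewrite [RHS]ffunE; apply: contrapT => ne; apply: no; exists i.
have Sx : vals nu m (vec (x%:F)) by exists x.
apply: Rle_trans (str _ _ Sx i); rewrite -[X in (X <= _)%RR]Rmult_1_r.
apply: Rmult_le_compat_l; first lra.
rewrite -abs_IZR; apply: IZR_le; lia.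
Qed.

End Truncation.

(** * Volumes *)

Lemma Un_cv_perturb (x y : nat -> R) L (err : nat -> R) E :
  Un_cv y L -> (forall eps, (0 < eps)%RR -> exists E, forall e, (E <= e)%N -> (err e <= eps)%RR) ->
  (forall e, (E <= e)%N -> (Rabs (x e - y e) <= err e)%RR) -> Un_cv x L.
Proof.
move=> yL err0 xy eps eps0.
have [n1 h1] := yL (eps / 2)%RR ltac:(lra).
have [n2 h2] := err0 (eps / 3)%RR ltac:(lra).
exists (n1 + (n2 + E))%N => n /leP nn; rewrite /R_dist.
have := h1 n ltac:(apply/leP; apply: leq_trans nn; exact: leq_addr).
have := h2 n (leq_trans (leq_trans (leq_addr _ _) (leq_addl _ _)) nn).
have := xy n (leq_trans (leq_trans (leq_addl _ _) (leq_addl _ _)) nn).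
rewrite /R_dist /Rabs; do 3! case: Rcase_abs => ?; lra.
Qed.

Section Volume.

Variables (A : idomainType) (m : A -> Prop) (p d : nat) (I : nat -> A -> Prop).
Variables (a : 'I_d -> R) (nu : {fraction A} -> 'I_d -> Z).
Hypotheses (loc : is_local m) (ok : OK_relative m a nu) (qa : Qlin_indep a).
Hypotheses (p1 : (1 < p)%N) (idI : forall e, is_ideal (I e)) (fam : p_family p I).

Local Notation "x %:F" := (@tofrac A x).
Local Notation vect := {ffun 'I_d -> Z}.
Local Notation vec := (vec nu).
Local Notation hgt := (hgt a nu).
Local Notation vge := (vge a nu).
Local Notation vals := (vals nu).
Local Notation top := (@top A).
Local Notation Q := (ppow p).

Variables (delta N C : R) (f : nat) (w wd : vect).
Local Notation cnt := (cnt a delta).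
Hypotheses (delta0 : (0 < delta)%RR) (str : forall J, in_strip a delta (vals J)).
Hypotheses (f0 : (0 < f)%N) (w0 : (0 <= ht a w)%RR).
Hypothesis bounds : forall J t0, is_ideal J -> (forall r, vge t0 (r%:F) -> J r) ->
  (f * cnt (vals top) (t0 - ht a w) <= colength J + f * cnt (vals J) t0)%N /\
  (colength J + f * cnt (vals J) t0 <= f * cnt (vals top) (t0 + ht a w))%N.
Hypothesis wd0 : (0 <= ht a wd)%RR.
Hypothesis deep : forall k (r : vect), (forall i, (0 <= r i < Z.of_nat k)%ZZ) ->
  vals top (wd *+ k + r).
Hypotheses (N1 : (1 <= N)%RR) (deltaN : (delta <= N)%RR) (C0 : (0 < C)%RR).
Hypothesis truncI : forall e r, vge (N * Q e)%RR (r%:F) -> I e r.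
Hypothesis truncC : forall e r, vge (C * Q e)%RR (r%:F) -> frob_pow m (p ^ e) r.

Local Notation G t := (INR (cnt (vals top) t)).
Local Notation tau e := (INR (cnt (vals (I e)) (N * Q e))).
Local Notation lam e := (INR (colength (I e))).

Lemma vol_seqE e : vol_seq p d I e = (lam e / Q e ^ d)%RR.
Proof. by []. Qed.

Lemma Qd_gt0 e : (0 < Q e ^ d)%RR.
Proof. by apply: pow_lt; have := ppow_ge1 p1 e; lra. Qed.

Lemma str_top : in_strip a delta (vals top). Proof. exact: str. Qed.
Lemma str_I e : in_strip a delta (vals (I e)). Proof. exact: str. Qed.

Lemma colength_lower e :
  (INR f * (G (N * Q e - ht a w) - tau e) <= lam e)%RR.
Proof.
have [/leP/le_INR h _] := bounds (idI e) (@truncI e).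
by move: h; rewrite -plusE -!multE plus_INR !mult_INR; lra.
Qed.

Lemma colength_upper e :
  (lam e <= INR f * (G (N * Q e + ht a w) - tau e))%RR.
Proof.
have [_ /leP/le_INR h] := bounds (idI e) (@truncI e).
by move: h; rewrite -plusE -!multE plus_INR !mult_INR; lra.
Qed.

Lemma G_mono t t' : (t <= t')%RR -> (G t <= G t')%RR.
Proof.
move=> tt; apply/le_INR/leP/(cnt_mono delta0 str_top str_top) => u Su ut.
by split=> //; lra.
Qed.

Lemma slab_volume : exists2 K, (0 <= K)%RR & forall Q t1 t2, (1 <= Q)%RR ->
  (0 < t1)%RR -> (t1 <= t2)%RR -> (N * Q <= t2 <= N * Q + ht a w)%RR ->
  (G t2 - G t1 <= K * (t2 - t1 + 1) / Q * Q ^ d)%RR.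
Proof.
have [||K K0 hK] := @cnt_slab_density d a delta delta0 N (N + ht a w) qa; try lra.
exists K => // q t1 t2 Q1 t10 t12 t2Q; apply: hK; [exact: str_top|lra|lra|lra|nra|nra].
Qed.

(** [G] and [tau] both converge by [cnt_cv] with the same [wd]: x in I_e gives x^(p^k) in I_(e+k),
    and [deep] supplies the cube. The colength differs from f (G - tau) by at most f times a slab of
    width ht w. *)
Lemma vol_cv : exists L, Un_cv (vol_seq p d I) L.
Proof.
have N0 : (0 < N)%RR by lra.
have [|LG cvG] := @cnt_cv p p1 d a delta delta0 qa (fun=> vals top) wd N (fun=> str_top) N0 wd0.
  move=> e k u r Su rk; rewrite mulrnDl -addrA; apply: (vals_top_add ok) => //.
    exact: (vals_top_muln ok).
  exact: deep.
have [|LT cvT] := @cnt_cv p p1 d a delta delta0 qa (fun e => vals (I e)) wd N str_I N0 wd0.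
  move=> e k u r [x [Ix x0 <-]] rk; rewrite mulrnDl -addrA addrC.
  apply: (vals_add ok) => //; last exact: deep.
  exists (x ^+ (p ^ k)); split; first exact: p_family_expn.
    by rewrite expf_neq0.
  by rewrite tofracXn (vecX ok) // tofrac_eq0.
have [K K0 hK] := slab_volume.
have [E hE] := ppow_large p1 (ht a w + 1).
exists (INR f * (LG - LT))%RR.
pose err e := (INR f * (K * (ht a w + 1)) / Q e)%RR.
apply: (@Un_cv_perturb _ (fun e => INR f * (G (N * Q e) / Q e ^ d - tau e / Q e ^ d))%RR _ err E).
- apply: CV_mult; last exact: CV_minus.
  by move=> eps eps0; exists 0%N => n _; rewrite /R_dist Rminus_diag Rabs_R0.
- by move=> eps; apply: ppow_inv_small.
move=> e /hE Qw; have Q1 := ppow_ge1 p1 e; have Qd := Qd_gt0 e.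
have NQ : (Q e <= N * Q e)%RR by nra.
have f1 := pos_INR f.
have h1 := hK (Q e) (N * Q e)%RR (N * Q e + ht a w)%RR Q1 ltac:(lra) ltac:(lra) ltac:(lra).
have h2 := hK (Q e) (N * Q e - ht a w)%RR (N * Q e)%RR Q1 ltac:(lra) ltac:(lra) ltac:(lra).
have h3 := colength_lower e; have h4 := colength_upper e.
rewrite (_ : N * Q e + ht a w - N * Q e + 1 = ht a w + 1)%RR in h1; last by ring.
rewrite (_ : N * Q e - (N * Q e - ht a w) + 1 = ht a w + 1)%RR in h2; last by ring.
rewrite vol_seqE /err; move: (G (N * Q e)) (G (N * Q e + ht a w)) (G (N * Q e - ht a w))
  (tau e) (lam e) h1 h2 h3 h4 => g g1 g2 t l h1' h2' h3 h4.
set D := (K * (ht a w + 1) / Q e)%RR in h1' h2'.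
have -> : (INR f * (K * (ht a w + 1)) / Q e = INR f * D)%RR by rewrite /D; field; lra.
have -> : (l / Q e ^ d - INR f * (g / Q e ^ d - t / Q e ^ d) =
   (l - INR f * (g - t)) / Q e ^ d)%RR by field; lra.
rewrite {1}/Rdiv Rabs_mult (Rabs_pos_eq (/ _)); last by left; apply: Rinv_0_lt_compat.
apply: (Rmult_le_reg_r (Q e ^ d)) => //.
rewrite Rmult_assoc Rinv_l; last lra.
rewrite Rmult_1_r Rmult_assoc.
have h5 := Rmult_le_compat_l _ _ _ f1 h1'; have h6 := Rmult_le_compat_l _ _ _ f1 h2'.
by rewrite /Rabs; case: Rcase_abs => _; lra.
Qed.

Lemma vol_pos_imp L : Un_cv (vol_seq p d I) L -> (0 < L)%RR ->
  exists e0, forall e, psubset (I (e + e0)%N) (frob_pow m (p ^ e)).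
Proof.
move=> cvL L0; apply: contrapT => no.
have [K K0 hK] := slab_volume.
have f1 := pos_INR f.
(* As Q n = Q e * Q k * Q e0 below, a slab of width ht w + C Q e Q k has relative size O(1 / Q e0);
   the 1 comes from the slab estimate. Thus e0 is fixed from L before e and x are known. *)
pose B := (INR f * (K * (ht a w + 1 + C)))%RR.
have [E1 hE1] := ppow_inv_small p1 B (ltac:(lra) : (0 < L / 2)%RR).
(* This keeps the lower end N Q n - C Q e Q k of the slab positive. *)
have [E2 hE2] := ppow_large p1 (C + 1)%RR.
pose e0 := (E1 + E2)%N.
have B1 : (B / Q e0 <= L / 2)%RR by apply/hE1/leq_addr.
have C1 : (C + 1 <= Q e0)%RR by apply/hE2/leq_addl.
have [e [x Ix nx]] : exists e, exists2 x, I (e + e0)%N x & ~ frob_pow m (p ^ e) x.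
  apply: contrapT => no'; apply: no; exists e0 => e x Ix; apply: contrapT => nx.
  by apply: no'; exists e, x.
have [x0 hx] : x != 0 /\ (hgt (x%:F) < C * Q e)%RR.
  split; first by apply/eqP => xe; apply: nx; apply: truncC; left; rewrite xe tofrac0.
  by apply: Rnot_le_lt => h; apply: nx; apply: truncC; right.
have small k : (vol_seq p d I (e + e0 + k) <= L / 2)%RR.
  set n := (e + e0 + k)%N; rewrite vol_seqE.
  have Qk := ppow_ge1 p1 k; have Qe := ppow_ge1 p1 e; have Qn := ppow_ge1 p1 n.
  have Qe0 := ppow_ge1 p1 e0.
  have Qd := Qd_gt0 n.
  have en : (Q n = Q e * Q k * Q e0)%RR by rewrite /n !ppow_add; ring.
  have P1 : (1 <= Q e * Q k)%RR by nra.
  have low : (G (N * Q n - C * (Q e * Q k)) <= tau n)%RR.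
    pose u := vec (x%:F) *+ (p ^ k).
    have := cnt_shift delta0 (N * Q n - ht a u)%RR (w := u) str_top (@str_I n).
    rewrite (_ : N * Q n - ht a u + ht a u = N * Q n)%RR; last by ring.
    move=> h; have /leP/le_INR : (cnt (vals top) (N * Q n - ht a u) <= cnt (vals (I n)) (N * Q n))%N.
      apply: h => v Sv; apply: (vals_add ok) => //.
      exists (x ^+ (p ^ k)); split; first exact: p_family_expn.
        by rewrite expf_neq0.
      by rewrite tofracXn (vecX ok) // tofrac_eq0.
    apply: Rle_trans; apply: G_mono; rewrite /u htMn -/(ppow p k) -/(hgt _); nra.
  have up := colength_upper n.
  have CQ : (C * (Q e * Q k) < N * Q n)%RR by rewrite en; nra.
  have h := hK (Q n) (N * Q n - C * (Q e * Q k))%RR (N * Q n + ht a w)%RR Qn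
    ltac:(lra) ltac:(nra) ltac:(lra).
  rewrite (_ : N * Q n + ht a w - (N * Q n - C * (Q e * Q k)) + 1 =
     ht a w + 1 + C * (Q e * Q k))%RR in h; last by ring.
  apply: Rle_trans B1; apply: (Rmult_le_reg_r (Q n ^ d)) => //.
  rewrite /Rdiv Rmult_assoc Rinv_l; last lra.
  rewrite Rmult_1_r.
  have h2 : (K * (ht a w + 1 + C * (Q e * Q k)) / Q n <= K * (ht a w + 1 + C) / Q e0)%RR.
    have -> : (K * (ht a w + 1 + C) / Q e0 =
        K * ((ht a w + 1 + C) * (Q e * Q k)) / Q n)%RR by rewrite en; field; lra.
    apply: Rmult_le_compat_r; first by left; apply: Rinv_0_lt_compat; lra.
    by apply: Rmult_le_compat_l => //; nra.
  have h3 : (lam n <= INR f * (K * (ht a w + 1 + C * (Q e * Q k)) / Q n * Q n ^ d))%RR.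
    apply: Rle_trans up _; apply: Rmult_le_compat_l => //; lra.
  apply: Rle_trans h3 _.
  have -> : (B * / Q e0 * Q n ^ d = INR f * (K * (ht a w + 1 + C) / Q e0 * Q n ^ d))%RR.
    by rewrite /B; field; lra.
  by apply: Rmult_le_compat_l => //; apply: Rmult_le_compat_r => //; lra.
have [M hM] := cvL (L / 2)%RR ltac:(lra).
have := hM (e + e0 + M)%N ltac:(apply/leP; exact: leq_addl).
by have := small M; rewrite /R_dist /Rabs; case: Rcase_abs => ?; lra.
Qed.

Lemma imp_vol_pos L e0 : Un_cv (vol_seq p d I) L ->
  (forall e, psubset (I (e + e0)%N) (frob_pow m (p ^ e))) -> (0 < L)%RR.
Proof.
move=> cvL sub.
have [K K0 hK] := slab_volume.
pose c1 := (1 + (ht a wd + l1 a))%RR.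
have [e1 he1] := ppow_large p1 (c1 / delta).
have f1 : (0 < INR f)%RR by apply: lt_0_INR; apply/ltP.
(* The translates are attached to the single point 0: a cube of side p^j based at p^j wd lies in the
   values of R, below height c1 Q j <= delta Q (e1 + j) by the choice of e1. *)
have G_low j : (Q j ^ d <= G (delta * Q (e1 + j)))%RR.
  have strip0 : in_strip a delta (fun u => u = 0).
    by move=> u -> i; rewrite ffunE ht0 Rabs_R0; lra.
  have pj : (0 < p ^ j)%N by rewrite expn_gt0; case: p p1.
  have := cnt_scale delta0 1%RR (k := (p ^ j)%N) (w := wd) strip0 str_top pj.
  move=> h; have {h} : ((p ^ j) ^ d * cnt (fun u => u = 0%R) 1 <=
      cnt (vals top) (INR (p ^ j) * (1 + (ht a wd + l1 a))))%N.
    by apply: h => u r -> rk; rewrite add0r; apply: deep.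
  move/leP/le_INR => h; apply: Rle_trans (Rle_trans _ _ _ _ h) _.
    rewrite -multE mult_INR.
    have -> : INR ((p ^ j) ^ d) = (Q j ^ d)%RR.
      by elim: (d) => [|i IH] //; rewrite expnS -multE mult_INR IH.
    rewrite -[X in (X <= _)%RR]Rmult_1_r; apply: Rmult_le_compat_l.
      by left; apply: Qd_gt0.
    apply: (le_INR 1); apply/leP; rewrite -[1%N]/(size [:: (0 : vect)]).
    apply: (size_le_cnt delta0 strip0) => // u; rewrite inE => /eqP->.
    by split=> //; rewrite ht0; lra.
  apply: G_mono; rewrite -/(ppow p j) -/c1 ppow_add.
  have := he1 e1 (leqnn _); have := ppow_ge1 p1 j => Qj.
  move/(Rmult_le_compat_l delta _ _ (Rlt_le _ _ delta0)).
  rewrite (_ : delta * (c1 / delta) = c1)%RR; last by field; lra.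
  by nra.
(* Half of the proportion f Q j^d / Q n^d of missed values; the other half absorbs the slab between
   N Q n - ht w and N Q n. *)
pose c := (INR f / (2 * Q (e1 + e0) ^ d))%RR.
have Qd0 := Qd_gt0 (e1 + e0).
have c0 : (0 < c)%RR by apply: Rdiv_lt_0_compat; lra.
have [E1 hE1] := ppow_inv_small p1 (INR f * (K * (ht a w + 1)))%RR c0.
have [E2 hE2] := ppow_large p1 (ht a w + 1)%RR.
have big j : (E1 + E2 <= j)%N -> (c <= vol_seq p d I (e1 + j + e0))%RR.
  move=> jE; set n := (e1 + j + e0)%N; rewrite vol_seqE.
  have jn : (j <= n)%N by rewrite /n addnAC leq_addl.
  have h1 : (INR f * (K * (ht a w + 1)) / Q n <= c)%RR.
    by apply: hE1; apply: leq_trans jn; apply: leq_trans jE; apply: leq_addr.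
  have h2 : (ht a w + 1 <= Q n)%RR.
    by apply: hE2; apply: leq_trans jn; apply: leq_trans jE; apply: leq_addl.
  have Qn := ppow_ge1 p1 n; have Qd := Qd_gt0 n.
  have NQ : (Q n <= N * Q n)%RR by nra.
  have tauG : (tau n + G (delta * Q (e1 + j)) <= G (N * Q n))%RR.
    rewrite -plus_INR; apply/le_INR/leP; rewrite plusE /cnt -size_cat.
    apply: (size_le_cnt delta0 str_top).
      rewrite cat_uniq !below_uniq andbT /=; apply/hasPn => u.
      move=> /(mem_below delta0 _ _ str_top)[_ ud]; apply/negP.
      move=> /(mem_below delta0 _ _ (@str_I n))[[r [Ir r0 er]] _].
      have [/eqP|] := frob_pow_height ok delta0 str (sub _ _ Ir).
        by rewrite tofrac_eq0 (negbTE r0).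
      by rewrite /hgt er -/(ppow p (e1 + j)); lra.
    have QQ : (Q (e1 + j) <= Q n)%RR.
      have -> : Q n = (Q (e1 + j) * Q e0)%RR by apply: ppow_add.
      by have := ppow_ge1 p1 e0; have := ppow_ge1 p1 (e1 + j); nra.
    move=> u; rewrite mem_cat => /orP[].
      by move=> /(mem_below delta0 _ _ (@str_I n))[[r [_ r0 er]] ut]; split=> //; exists r.
    move=> /(mem_below delta0 _ _ str_top)[Su ud]; split=> //.
    by have := ppow_ge1 p1 (e1 + j); nra.
  have h3 := hK (Q n) (N * Q n - ht a w)%RR (N * Q n)%RR Qn ltac:(lra) ltac:(lra) ltac:(lra).
  rewrite (_ : N * Q n - (N * Q n - ht a w) + 1 = ht a w + 1)%RR in h3; last by ring.
  have h4 := colength_lower n; have h5 := G_low j.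
  apply: (Rmult_le_reg_r (Q n ^ d)) => //.
  rewrite /Rdiv Rmult_assoc Rinv_l; last lra.
  rewrite Rmult_1_r; apply: Rle_trans h4.
  have h6 : (INR f * (Q j ^ d - K * (ht a w + 1) / Q n * Q n ^ d) <=
      INR f * (G (N * Q n - ht a w) - tau n))%RR.
    by apply: Rmult_le_compat_l; lra.
  apply: Rle_trans h6.
  have en : (Q n ^ d = Q (e1 + e0) ^ d * Q j ^ d)%RR.
    by rewrite -Rpow_mult_distr; congr (_ ^ d)%RR; rewrite /n !ppow_add; ring.
  have e2 : (INR f * Q j ^ d = 2 * c * Q n ^ d)%RR by rewrite en /c; field; lra.
  have e3 : (INR f * (K * (ht a w + 1) / Q n * Q n ^ d) =
     INR f * (K * (ht a w + 1)) / Q n * Q n ^ d)%RR by field; lra.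
  rewrite Rmult_minus_distr_l e2 e3.
  by have := Rmult_le_compat_r _ _ _ (Rlt_le _ _ Qd) h1; lra.
apply: Rnot_le_lt => L0.
have [M hM] := cvL c c0.
pose j := (E1 + E2 + M)%N.
have := hM (e1 + j + e0)%N
  ltac:(apply/leP; rewrite /j addnAC addnA; exact: leq_addl).
have := big j (leq_addr _ _).
by rewrite /R_dist /Rabs; case: Rcase_abs => ?; lra.
Qed.

End Volume.

Theorem mainTheorem5 (A : idomainType) (m : A -> Prop) (p d : nat)
    (I : nat -> A -> Prop) :
  noetherian A -> is_local m -> krull_dim A d -> is_OK m d ->
  prime p -> (p%:R : A)%R = 0%R ->
  (forall e, m_primary m (I e)) -> p_family p I ->
  ((exists L : R, Un_cv (vol_seq p d I) L /\ Rlt R0 L) <->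
   (exists e0 : nat, forall e : nat, psubset (I (e + e0)%N) (frob_pow m (expn p e)))).
Proof.
move=> noeth loc _ [a [nu [qa ok]]] /prime_gt1 p1 _ prim fam.
have idI e : is_ideal (I e) by case: (prim e).
have [delta delta0 str] := vals_strip ok.
have [f [w [f0 w0 bounds]]] := colength_bounds loc ok qa delta0 str.
have [wd wd0 deep] := deep_value ok.
have [xs [B [B0 xm trunc]]] := truncation noeth loc ok.
have [c hc] := common_exponent (prim 0%N) xm.
have pe e : (0 < p ^ e)%N by rewrite expn_gt0 (ltnW p1).
(* N >= 1 keeps N Q n above the heights at which the slab estimate holds, and N >= delta puts the
   values of height below delta q under the truncation height. *)
pose N := Rmax (INR (size xs * c + 1) * B) (Rmax delta 1).
have Nmax := Rmax_r (INR (size xs * c + 1) * B) (Rmax delta 1).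
have N1 : (1 <= N)%RR by apply: Rle_trans Nmax; apply: Rmax_r.
have Nd : (delta <= N)%RR by apply: Rle_trans Nmax; apply: Rmax_l.
have truncI e r : vge a nu (N * ppow p e)%RR (tofrac r) -> I e r.
  move=> hr; apply: (trunc (I e) c (p ^ e)%N) => // [x xxs|].
    by rewrite exprM -[e]add0n; apply: p_family_expn => //; apply: hc.
  apply: vge_le hr; apply: Rmult_le_compat_r; first exact: pos_INR.
  exact: Rmax_l.
pose C := (INR (size xs * 1 + 1) * B)%RR.
have C0 : (0 < C)%RR.
  by apply: Rmult_lt_0_compat => //; apply: lt_0_INR; rewrite addn1; apply/ltP.
have truncC e r : vge a nu (C * ppow p e)%RR (tofrac r) -> frob_pow m (p ^ e) r.
  apply: (trunc (frob_pow m (p ^ e)) 1%N (p ^ e)%N) => //; first exact: ideal_gen_ideal.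
  by move=> x /xm mx; rewrite mul1n; apply: frob_pow_mem.
split=> [[L [cvL L0]]|[e0 sub]].
  exact: (vol_pos_imp ok qa p1 idI fam delta0 str w0 bounds N1 Nd C0 truncI truncC cvL L0).
(* Here the existence of the limit has to be proved as well as its positivity. *)
have [L cvL] := vol_cv ok qa p1 idI fam delta0 str w0 bounds wd0 deep N1 truncI.
exists L; split=> //.
exact: (imp_vol_pos ok qa p1 idI delta0 str f0 w0 bounds deep N1 Nd truncI cvL sub).
Qed.
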